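(* Let $M$ be an orientable combinatorial 3-manifold and let $S\subset M$ be a (non-empty) closed, connected, orientable normal surface. Then $$2\,g(S)\ <\ 7\,f_0(S),$$ where $g(S)$ is the genus of $S$ and $f_0(S)$ is the number of vertices in the normal cell structure of $S$.
   Context: A combinatorial 3-manifold is a (finite) simplicial complex triangulating a 3-manifold in which a simplicial neighbourhood (link) of each vertex is a simplicial triangulation of the 2-sphere. A normal surface in $M$ is a properly embedded surface that meets each tetrahedron in a finite disjoint collection of normal triangles (each separating one vertex of the tetrahedron from the other three) and normal quadrilaterals (each separating two vertices from the other two). This gives $S$ a cell structure whose vertices are the intersection points of $S$ with the edges of $M$. *)

(* Defs.v *)
From HB Require Import structures.
From mathcomp Require Import all_boot all_order all_algebra finmap.
From mathcomp Require Import all_classical all_reals topology normedtype.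

Set Implicit Arguments.
Unset Strict Implicit.
Unset Printing Implicit Defensive.

Import Order.TTheory GRing.Theory Num.Theory.
Import numFieldNormedType.Exports.

Local Open Scope ring_scope.
Local Open Scope classical_set_scope.

(* Finite complexes on vertices drawn from 'I_n; only nonempty simplices are
   listed, and an element of 'I_n need not be a vertex. *)
Definition simplicial_complex n (K : {set {set 'I_n}}) : Prop :=
  forall s, s \in K ->
    s != finset.set0 /\
    forall t : {set 'I_n}, t \subset s -> t != finset.set0 -> t \in K.

Definition link n (K : {set {set 'I_n}}) (v : 'I_n) : {set {set 'I_n}} :=
  [set t | [&& t != finset.set0, v \notin t & (v |: t)%SET \in K]]%SET.

Definition supp (R : realType) n (x : 'rV[R]_n) : {set 'I_n} :=
  [set i | x 0 i != 0]%SET.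

(* Barycentric coordinates: [x] lies in the relative interior of the simplex
   [supp x]. *)
Definition realization (R : realType) n (K : {set {set 'I_n}}) : set 'rV[R]_n :=
  [set x : 'rV[R]_n |
    [/\ forall i, 0 <= x 0 i, \sum_i x 0 i = 1 & supp x \in K]].

Definition sphere2 (R : realType) : set 'rV[R]_3 :=
  [set x : 'rV[R]_3 | \sum_i x 0 i ^+ 2 = 1].

Definition homeomorphic (X Y : topologicalType) (A : set X) (B : set Y) :
    Prop :=
  exists (f : X -> Y) (g : Y -> X),
    [/\ {within A, continuous f}, {within B, continuous g},
        forall x, A x -> B (f x) /\ g (f x) = x &
        forall y, B y -> A (g y) /\ f (g y) = y].

Definition combinatorial_3manifold (R : realType) n (K : {set {set 'I_n}}) :
    Prop :=
  simplicial_complex K /\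
  forall v : 'I_n, [set v]%SET \in K ->
    homeomorphic (@realization R n (link K v)) (@sphere2 R).

(* Parity of the position of the vertex opposite to the facet [t] in the
   increasing ordering of the vertices of [s], i.e. the sign of [t] in the
   simplicial boundary of [s]. *)
Definition incidence n (s t : {set 'I_n}) : bool :=
  odd #|[set u in s | [exists v in s :\: t, (u < v)%N]]%SET|.

(* [o s] is the sign of the chosen orientation of the tetrahedron [s] relative
   to the increasing ordering of its vertices; two tetrahedra with a common
   triangle must induce opposite orientations on it. *)
Definition orientable_3complex n (K : {set {set 'I_n}}) : Prop :=
  exists o : {set 'I_n} -> bool,
    forall s s' : {set 'I_n}, s \in K -> s' \in K ->
      #|s| = 4%N -> #|s'| = 4%N -> #|s :&: s'|%SET = 3%N ->
      o s (+) incidence s (s :&: s') != o s' (+) incidence s' (s :&: s').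

(* A normal disc is recorded as the tetrahedron containing it together with the
   set of its corners, the points where it meets the edges. *)
Definition ndisc (R : realType) n : choiceType :=
  ({set 'I_n} * {fset 'rV[R]_n})%type.

(* [D] separates the vertices in [A] from those in [D.1 :\: A]: it meets
   exactly the edges joining these two sets, once each, in interior points.
   It is a normal triangle if #|A| = 1 and a normal quadrilateral if
   #|A| = 2. *)
Definition normal_disc (R : realType) n (K : {set {set 'I_n}}) (D : ndisc R n) :
    Prop :=
  [/\ D.1 \in K, #|D.1| = 4%N &
    exists A : {set 'I_n},
      [/\ A \subset D.1, #|A| = 1%N \/ #|A| = 2%N,
          forall p, p \in D.2 -> realization K p /\
            exists a b, [/\ a \in A, b \in (D.1 :\: A)%SET
                         & supp p = [set a; b]%SET] &
          forall a b, a \in A -> b \in (D.1 :\: A)%SET ->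
            exists! p, p \in D.2 /\ supp p = [set a; b]%SET]].

(* The boundary of a normal disc has one arc in each triangle of the
   tetrahedron that it meets; [side D p q] says that the corners [p] and [q]
   are the endpoints of such an arc. *)
Definition side (R : realType) n (D : ndisc R n) (p q : 'rV[R]_n) : bool :=
  [&& p \in D.2, q \in D.2 & #|supp p :|: supp q|%SET == 3%N].

(* The boundary curve, with straight arcs. *)
Definition boundary (R : realType) n (D : ndisc R n) : set 'rV[R]_n :=
  [set x : 'rV[R]_n | exists p q (t : R),
     [/\ side D p q, 0 <= t <= 1 & x = (1 - t) *: p + t *: q]].

(* A normal surface is recorded by its finite set of normal discs.  Whether
   discs of a tetrahedron with given corners are disjoint depends only on the
   order of the corners along the edges, and can be tested on the straight
   boundary curves: disjoint curves on the boundary of a ball bound disjoint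
   discs, and two arcs in a triangle joining given points of its sides can be
   disjoint only if the segments are.  The last clause says that both tetrahedra
   at a triangle see the same arcs in it. *)
Definition closed_normal_surface (R : realType) n (K : {set {set 'I_n}})
    (S : {fset ndisc R n}) : Prop :=
  [/\ forall D, D \in S -> normal_disc K D,
      forall D D', D \in S -> D' \in S -> D.1 = D'.1 -> D <> D' ->
        (boundary D `&` boundary D')%classic = set0 &
      forall D p q (s : {set 'I_n}), D \in S -> side D p q ->
        s \in K -> #|s| = 4%N -> (supp p :|: supp q)%SET \subset s ->
        exists D', [/\ D' \in S, D'.1 = s & side D' p q]].

Definition vertices (R : realType) n (S : {fset ndisc R n}) : {fset 'rV[R]_n} :=
  (\bigcup_(D <- S) D.2)%fset.

Definition edges (R : realType) n (S : {fset ndisc R n}) :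
    {fset {fset 'rV[R]_n}} :=
  (\bigcup_(D <- S) [fset [fset p; q] | p in D.2, q in D.2 & side D p q])%fset.

Definition f0 (R : realType) n (S : {fset ndisc R n}) : nat :=
  #|` vertices S|%fset.

Definition f1 (R : realType) n (S : {fset ndisc R n}) : nat :=
  #|` edges S|%fset.

Definition f2 (R : realType) n (S : {fset ndisc R n}) : nat :=
  #|` S|%fset.

Definition connected_surface (R : realType) n (S : {fset ndisc R n}) : Prop :=
  forall D D' : S,
    connect [rel x y : S | ((val x).2 `&` (val y).2 != fset0)%fset] D D'.

(* [d D p q] says that the chosen orientation of [D] traverses its side [p q]
   from [p] to [q]; discs with a common side must traverse it in opposite
   directions. *)
Definition orientable_surface (R : realType) n (S : {fset ndisc R n}) : Prop :=
  exists d : ndisc R n -> 'rV[R]_n -> 'rV[R]_n -> bool,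
    [/\ forall D p q, D \in S -> side D p q -> d D p q = ~~ d D q p,
        forall D p, D \in S -> p \in D.2 ->
          exists! q, side D p q /\ d D p q &
        forall D D' p q, D \in S -> D' \in S -> D <> D' ->
          side D p q -> side D' p q -> d D p q = ~~ d D' p q].

Definition euler_char (R : realType) n (S : {fset ndisc R n}) : int :=
  (f0 S)%:Z - (f1 S)%:Z + (f2 S)%:Z.

(* The genus of a closed connected orientable surface, from chi = 2 - 2 g. *)
Definition genus (R : realType) n (S : {fset ndisc R n}) : rat :=
  (2 - euler_char S)%:~R / 2.

(* Main.v *)
Require Import Defs.
From mathcomp Require Import all_boot all_order all_algebra finmap.
From mathcomp Require Import all_classical all_reals.
From mathcomp Require Import interval_inference topology normedtype realfun.
From mathcomp Require Import ring lra zify.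

(** In a triangle of [M] the arcs of [S] around a corner [x] are nested, so an
    arc joins points that have the same rank, counted from [x], on the two edges
    at [x].  Hence the arcs around [x] of a given rank form a subgraph of the link
    of [x].  The link is a sphere, hence has no first cohomology mod 2, and by
    orientability of [M] each of its edges lies in at most two triangles, so such
    a subgraph satisfies Euler's bound: at most three times as many edges as
    vertices.  Every vertex of [S] has a rank from each of the two ends of its
    edge, and summing gives [f1 <= 6 f0], which is stronger than the claim.

    The cohomology statement comes from contracting a punctured sphere and
    discretizing the contraction.  That all tetrahedra around an edge see the
    same points of [S] on it, needed to compare ranks, follows from connectedness
    of the link of the edge, which is again a consequence of the vanishing of
    cohomology together with connectedness of a punctured sphere. *)

Set Implicit Arguments.
Unset Strict Implicit.
Unset Printing Implicit Defensive.

Import Order.TTheory GRing.Theory Num.Theory.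
Import numFieldNormedType.Exports.

Local Open Scope ring_scope.

(** * Edge bound for graphs on a complex without first cohomology *)

(** Dimension count: the row kernel of [B] has dimension at least [#|G| - #|Q|], and it lies in the
    row space of [A], of dimension at most [#|V|]. *)
Lemma card_le_of_ker_sub_im (F : fieldType) (E X T : finType) (G : {set E})
    (V : {set X}) (Q : {set T}) (b : E -> T -> F) (a : X -> E -> F) :
  (forall y : E -> F,
     (forall e, e \notin G -> y e = 0) ->
     (forall r, r \in Q -> \sum_(e in G) y e * b e r = 0) ->
     exists phi : X -> F,
       forall e, e \in G -> y e = \sum_(v in V) phi v * a v e) ->
  (#|G| <= #|V| + #|Q|)%N.
Proof.
move=> H.
pose B := \matrix_(i < #|G|, j < #|Q|) b (enum_val i) (enum_val j).
pose A := \matrix_(k < #|V|, i < #|G|) a (enum_val k) (enum_val i).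
have sBA : (kermx B <= A)%MS.
  apply/rV_subP => u /sub_kermxP uB.
  pose y (e : E) := \sum_(i < #|G|) u 0 i * (e == enum_val i)%:R.
  have yE i : y (enum_val i) = u 0 i.
    rewrite /y (bigD1 i) //= eqxx mulr1 big1 ?addr0 // => j ji.
    by rewrite (inj_eq enum_val_inj) eq_sym (negbTE ji) mulr0.
  have yG e : e \notin G -> y e = 0.
    move=> eG; rewrite /y big1 // => i _.
    case: eqP => [ei|]; last by rewrite mulr0.
    by move: eG; rewrite ei enum_valP.
  have yQ r : r \in Q -> \sum_(e in G) y e * b e r = 0.
    move=> rQ; move/matrixP: uB => /(_ 0 (enum_rank_in rQ r)).
    rewrite !mxE => E0; rewrite -[RHS]E0 [LHS]big_enum_val /=; apply: eq_bigr => i _.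
    by rewrite yE !mxE enum_rankK_in.
  have [phi phiE] := H y yG yQ.
  apply/submxP; exists (\row_k phi (enum_val k)).
  apply/rowP => i; rewrite -yE phiE ?enum_valP // !mxE [LHS]big_enum_val /=.
  by apply: eq_bigr => k _; rewrite !mxE.
have := mxrankS sBA; rewrite mxrank_ker.
have := rank_leq_row A; have := rank_leq_col B; lia.
Qed.

Lemma addrr_F2 (x : 'F_2) : x + x = 0.
Proof. exact: (@addrr_pchar2 'F_2 (pchar_Fp (isT : prime 2))). Qed.

Lemma natr_F2 (k : nat) : k%:R = (odd k)%:R :> 'F_2.
Proof.
elim: k => // k IHk; rewrite -natr1 IHk /=.
by case: (odd k); rewrite /= ?addrr_F2 ?add0r.
Qed.

Definition coboundary (E T : finType) (inc : E -> T -> bool) (y : E -> 'F_2)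
    (t : T) : 'F_2 :=
  \sum_(e | inc e t) y e.

(** The dual graph cut along [G]. Its components play the role of the complementary regions of a
    graph drawn on a surface. *)
Definition dual_adj (E T : finType) (inc : E -> T -> bool) (G : {set E}) :
    rel T :=
  [rel t u | [exists e, [&& e \notin G, inc e t & inc e u]]].

(** The boundary of [A] as a mod 2 chain. *)
Definition cell_bd (E T : finType) (inc : E -> T -> bool) (A : {set T}) :
    {set E} :=
  [set e | odd #|[set t in A | inc e t]|].

Definition face_of (E T : finType) (inc : E -> T -> bool) (G : {set E})
    (t : T) : {set T} :=
  [set u | connect (dual_adj inc G) t u].

(** A face with a free edge off [G]. A cocycle defect can be pushed out through that edge, so such a
    face imposes no condition on a cochain. *)
Definition open_face (E T : finType) (inc : E -> T -> bool) (G : {set E})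
    (t : T) : bool :=
  [exists u in face_of inc G t,
     [exists e, [&& e \notin G, inc e u & #|[set w | inc e w]| == 1%N]]].

(** A face is represented by the root of its component. Faces without boundary are left out: they
    impose no condition and would spoil the count of three edges per face. *)
Definition closed_faces (E T : finType) (inc : E -> T -> bool) (G : {set E}) :
    {set T} :=
  [set r | [&& fingraph.root (dual_adj inc G) r == r, ~~ open_face inc G r
             & cell_bd inc (face_of inc G r) != finset.set0]].

Lemma dual_adj_sym (E T : finType) (inc : E -> T -> bool) (G : {set E}) :
  symmetric (dual_adj inc G).
Proof.
by move=> t u; apply/existsP/existsP => -[e /and3P[eG et eu]];
  exists e; rewrite eG et eu.
Qed.

Lemma coboundaryD (E T : finType) (inc : E -> T -> bool) (y z : E -> 'F_2) t :
  coboundary inc (fun e => y e + z e) t =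
  coboundary inc y t + coboundary inc z t.
Proof. exact: big_split. Qed.

Lemma coboundary_delta (E T : finType) (inc : E -> T -> bool) (e : E) t :
  coboundary inc (fun e' => (e' == e)%:R) t = (inc e t)%:R.
Proof.
rewrite /coboundary big_mkcond (bigD1 e) //= eqxx big1 ?addr0; last first.
  by move=> i /negbTE ->; case: ifP.
by case: (inc e t).
Qed.

(** The cochain is the sum of the edges crossed by a dual path: intermediate cells are entered and
    left once, which cancels mod 2. *)
Lemma dual_path_cochain (E T : finType) (inc : E -> T -> bool) (G : {set E})
    (t u : T) :
  (forall e, (#|[set w | inc e w]| <= 2)%N) ->
  connect (dual_adj inc G) t u ->
  exists z : E -> 'F_2, (forall e, e \in G -> z e = 0) /\
    forall w, coboundary inc z w = (w == t)%:R + (w == u)%:R.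
Proof.
move=> inc2 /connectP[p]; elim: p t => [|v p IHp] t /=.
  move=> _ ->; exists (fun=> 0); split=> // w.
  by rewrite addrr_F2; apply: big1.
case/andP => /existsP[e /and3P[eG et ev]] pv ulast.
have [z [zG zE]] := IHp v pv ulast.
have [tv|tv] := eqVneq t v; first by exists z; rewrite tv.
exists (fun e' => (e' == e)%:R + z e'); split=> [e' e'G|w].
  by rewrite zG // addr0; case: eqP => // ee; move: eG; rewrite -ee e'G.
rewrite coboundaryD coboundary_delta zE addrA; congr (_ + _).
have -> : inc e w = (w == t) || (w == v).
  have sub : [set t; v]%SET \subset [set w | inc e w]%SET.
    by apply/fintype.subsetP => s /finset.set2P[] ->; rewrite inE.
  have /eqP/finset.setP/(_ w) : [set t; v]%SET == [set w | inc e w]%SET.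
    by rewrite eqEcard sub cards2 tv inc2.
  by rewrite !inE => <-.
case: eqVneq => [->|_] /=; first by rewrite (negbTE tv) addr0.
exact: addrr_F2.
Qed.

(** Stokes' formula mod 2, by exchanging the two sums. *)
Lemma sum_coboundary (E T : finType) (inc : E -> T -> bool) (A : {set T})
    (y : E -> 'F_2) :
  \sum_(t in A) coboundary inc y t = \sum_(e in cell_bd inc A) y e.
Proof.
rewrite /coboundary (exchange_big_dep predT) //= [RHS]big_mkcond /=.
apply: eq_bigr => e _; rewrite sumr_const -mulr_natl natr_F2 inE.
rewrite [in LHS](_ : #|_| = #|[set t in A | inc e t]%SET|); last first.
  by apply: eq_card => t; rewrite !inE.
by case: odd; rewrite ?mul1r ?mul0r.
Qed.

(* A cochain on [G] whose sums over the boundaries of the closed faces vanish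
   extends to a cocycle: push the defect of each cell along a dual path to the
   root of its face, or out through an edge that lies in a single cell. *)
Lemma extend_cocycle (E T : finType) (inc : E -> T -> bool) (G : {set E})
    (y : E -> 'F_2) :
  (forall e, (#|[set w | inc e w]| <= 2)%N) ->
  (forall e, e \notin G -> y e = 0) ->
  (forall r, r \in closed_faces inc G ->
     \sum_(e in G) y e * (e \in cell_bd inc (face_of inc G r))%:R = 0) ->
  exists y' : E -> 'F_2, (forall e, e \in G -> y' e = y e) /\
    forall t, coboundary inc y' t = 0.
Proof.
move=> inc2 yG yQ; set adj := dual_adj inc G.
have csym : connect_sym adj := sym_connect_sym (@dual_adj_sym _ _ _ _).
have zex t : exists z : E -> 'F_2, (forall e, e \in G -> z e = 0) /\
    forall w, coboundary inc z w =
      (w == t)%:R + ((w == fingraph.root adj t) && ~~ open_face inc G t)%:R.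
  case: (boolP (open_face inc G t)) => [|_]; last first.
    have [z [zG zE]] := dual_path_cochain inc2 (connect_root adj t).
    by exists z; split=> // w; rewrite zE andbT.
  case/existsP => u /andP[]; rewrite inE => tu /existsP[e /and3P[eG eu e1]].
  have [z [zG zE]] := dual_path_cochain inc2 tu.
  exists (fun e' => (e' == e)%:R + z e'); split=> [e' e'G|w].
    by rewrite zG // addr0; case: eqP => // ee; move: eG; rewrite -ee e'G.
  rewrite coboundaryD coboundary_delta zE andbF addr0 addrCA.
  have -> : inc e w = (w == u).
    case/cards1P: e1 => x xE; move: eu.
    have incE v : inc e v = (v == x).
      by have /finset.setP/(_ v) := xE; rewrite !inE.
    by rewrite !incE => /eqP ->.
  by rewrite addrr_F2 addr0.
pose Z t := sval (cid (zex t)).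
have ZG t e : e \in G -> Z t e = 0 by case: (svalP (cid (zex t))) => + _; apply.
have ZE t w : coboundary inc (Z t) w =
    (w == t)%:R + ((w == fingraph.root adj t) && ~~ open_face inc G t)%:R.
  by case: (svalP (cid (zex t))) => _; apply.
(* Each [Z t] moves the defect at [t] to the root of its face, or removes it if the face is open.
   Only roots of faces that are not open can keep a defect, namely the total defect of the face. *)
exists (fun e => y e + \sum_t coboundary inc y t * Z t e); split=> [e eG|w].
  by rewrite big1 ?addr0 // => t _; rewrite ZG // mulr0.
rewrite coboundaryD.
rewrite [X in _ + X](_ : _ =
    \sum_t coboundary inc y t * coboundary inc (Z t) w); last first.
  by rewrite {1}/coboundary exchange_big /=; apply: eq_bigr => t _; rewrite -mulr_sumr.
under eq_bigr => t _ do rewrite ZE mulrDr.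
rewrite big_split /= [X in _ + (X + _)](bigD1 w) //= eqxx mulr1.
rewrite [X in _ + (_ + X + _)]big1 ?addr0; last first.
  by move=> t tw; rewrite eq_sym (negbTE tw) mulr0.
rewrite addrA addrr_F2 add0r.
case: (boolP (fingraph.root adj w == w)) => rw; last first.
  apply: big1 => t _; case: eqP => [wt|_]; last by rewrite mulr0.
  by move: rw; rewrite wt root_root ?eqxx.
have openE t : t \in face_of inc G w -> open_face inc G t = open_face inc G w.
  rewrite inE => wt; rewrite /open_face.
  suff -> : face_of inc G t = face_of inc G w by [].
  by apply/finset.setP => u; rewrite !inE (same_connect csym wt).
have rE t : (w == fingraph.root adj t) = (t \in face_of inc G w).
  by rewrite inE -[w in LHS](eqP rw) (root_connect csym).
transitivity (if open_face inc G w then 0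
    else \sum_(t in face_of inc G w) coboundary inc y t).
  case: ifP => op.
    apply: big1 => t _; rewrite rE; case: (boolP (t \in _)) => tw.
      by rewrite openE // op mulr0.
    by rewrite mulr0.
  rewrite [RHS]big_mkcond; apply: eq_bigr => t _; rewrite rE.
  case: ifP => [tw|_]; last by rewrite mulr0.
  by rewrite openE // op mulr1.
case: ifP => // op; rewrite sum_coboundary.
case: (eqVneq (cell_bd inc (face_of inc G w)) finset.set0) => [->|bd0].
  by rewrite big1 // => e; rewrite inE.
rewrite -[RHS](yQ w) ?inE ?rw ?op //.
rewrite [RHS]big_mkcond [LHS]big_mkcond; apply: eq_bigr => e _.
case: (boolP (e \in G)) => eG; last by rewrite yG ?if_same.
by case: (e \in _); rewrite ?mulr1 ?mulr0.
Qed.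

(** Double count of pairs of a closed face and a boundary edge: each face has at least three such
    edges, all in [G], and an edge bounds at most two faces. *)
Lemma card_closed_faces (E T : finType) (inc : E -> T -> bool) (G : {set E}) :
  (forall e, (#|[set w | inc e w]| <= 2)%N) ->
  (forall A, cell_bd inc A != finset.set0 -> (2 < #|cell_bd inc A|)%N) ->
  (3 * #|closed_faces inc G| <= 2 * #|G|)%N.
Proof.
move=> inc2 bd3; set adj := dual_adj inc G.
have csym : connect_sym adj := sym_connect_sym (@dual_adj_sym _ _ _ _).
set Q := closed_faces inc G; pose bd r := cell_bd inc (face_of inc G r).
(* All cells at an edge off [G] lie in one face. If their number is odd it is one, and the face is
   open. *)
have bdG r : r \in Q -> bd r \subset G.
  rewrite inE => /and3P[_ cl _]; apply/fintype.subsetP => e; rewrite inE => oe.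
  apply/negPn/negP => eG; set A := [set _ in _ | _]%SET in oe.
  have /card_gt0P[t] : (0 < #|A|)%N by case: #|A| oe.
  rewrite inE => /andP[tr et].
  have sA : A \subset [set w | inc e w]%SET.
    by apply/fintype.subsetP => w; rewrite !inE => /andP[].
  have /eqP AE : A == [set w | inc e w]%SET.
    rewrite finset.eqEsubset sA; apply/fintype.subsetP => w; rewrite !inE => ew.
    rewrite ew andbT; move: tr; rewrite !inE => /connect_trans; apply.
    by apply: connect1; apply/existsP; exists e; rewrite eG et ew.
  move/negP: cl; apply; apply/existsP; exists t; rewrite tr /=.
  apply/existsP; exists e; rewrite eG et /= -AE.
  by move: oe (inc2 e); rewrite -AE; case: #|A| => [|[|[|]]].
have -> : (3 * #|Q| = \sum_(r in Q) 3)%N by rewrite sum_nat_const mulnC.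
apply: (@leq_trans (\sum_(r in Q) #|bd r|)).
  by apply: leq_sum => r; rewrite inE => /and3P[_ _ /bd3].
have -> : (\sum_(r in Q) #|bd r| = \sum_(r in Q) \sum_(e in G) (e \in bd r))%N.
  apply: eq_bigr => r rQ; rewrite -sum1_card big_mkcond [RHS]big_mkcond /=.
  apply: eq_bigr => e _; case: (boolP (e \in bd r)) => eb; last by case: ifP.
  by rewrite (fintype.subsetP (bdG r rQ)).
rewrite exchange_big /= mulnC -sum_nat_const; apply: leq_sum => e eG.
apply: leq_trans (inc2 e).
have -> : (\sum_(r in Q) (e \in bd r) = #|[set r in Q | e \in bd r]|)%N.
  rewrite -sum1_card big_mkcond [RHS]big_mkcond /=; apply: eq_bigr => r _.
  by rewrite inE; case: (r \in Q); case: (e \in _).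
(* A face with [e] in its boundary contains a cell at [e], whose root recovers the face. *)
apply: leq_trans (leq_imset_card (fingraph.root adj) _).
apply/subset_leq_card/fintype.subsetP => r; rewrite inE => /andP[rQ].
rewrite inE => oe; set A := [set _ in _ | _]%SET in oe.
have /card_gt0P[t] : (0 < #|A|)%N by case: #|A| oe.
rewrite !inE => /andP[rt et]; apply/imsetP; exists t; first by rewrite inE.
move: rQ; rewrite inE => /and3P[/eqP rr _ _]; rewrite -{1}rr.
by apply/eqP; rewrite (root_connect csym).
Qed.

(** * Boundaries of sets of triangles in a simplicial complex *)

(** Edges and triangles share the type [{set 'I_n}]; subsets that are not of the right kind are
    incident to nothing and so have no effect on sums. *)
Definition edge_inc n (P : {set {set 'I_n}}) (e t : {set 'I_n}) : bool :=
  [&& t \in P, #|e| == 2%N & e \subset t].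

(** With even degrees a walk never gets stuck: an edge [ab] continues by [ac] and then by [cd], and
    these three edges are distinct. *)
Lemma even_degrees_card n (B : {set {set 'I_n}}) :
  (forall e, e \in B -> #|e| = 2%N) ->
  (forall v, ~~ odd #|[set e in B | v \in e]|) ->
  B != finset.set0 -> (2 < #|B|)%N.
Proof.
move=> B2 ev /set0Pn[e eB].
have next v f : f \in B -> v \in f ->
    exists w, [/\ w != v, [set v; w]%SET \in B & [set v; w]%SET != f].
  move=> fB vf; have := ev v; rewrite (cardsD1 f) inE fB vf /= negbK => od.
  have /card_gt0P[g] : (0 < #|[set e in B | v \in e]%SET :\ f|)%N.
    by case: #|_| od.
  rewrite !inE => /and3P[gf gB vg].
  have /eqP/cards2P[x [y [xy gE]]] := B2 g gB.
  move: vg; rewrite gE !inE => /orP[] /eqP vE.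
    by exists y; rewrite vE -gE eq_sym.
  by exists x; rewrite vE finset.setUC -gE.
have /eqP/cards2P[a [b [ab eE]]] := B2 e eB.
have ae : a \in e by rewrite eE !inE eqxx.
have [c [ca acB ace]] := next a e eB ae.
have [|d [dc cdB cda]] := next c _ acB; first by rewrite !inE eqxx orbT.
have cNe : c \notin e.
  rewrite eE !inE negb_or ca /=; apply: contra ace => /eqP ->.
  by rewrite eE.
have cde : [set c; d]%SET != e.
  by apply: contraNneq cNe => <-; rewrite !inE eqxx.
have sub : e |: [set [set a; c]; [set c; d]]%SET \subset B.
  apply/fintype.subsetP => f; rewrite !inE => /or3P[] /eqP -> //.
apply: leq_trans (subset_leq_card sub).
by rewrite cardsU1 cards2 !inE negb_or eq_sym ace eq_sym cde eq_sym cda.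
Qed.

(** The boundary of a boundary vanishes. Stokes' formula is applied to the indicator of the edges at
    [v], of which a triangle has two or none. *)
Lemma cell_bd_even n (P A : {set {set 'I_n}}) v :
  (forall t, t \in P -> #|t| = 3%N) ->
  ~~ odd #|[set e in cell_bd (edge_inc P) A | v \in e]|.
Proof.
move=> P3; pose y (e : {set 'I_n}) : 'F_2 := (v \in e)%:R.
have : \sum_(e in cell_bd (edge_inc P) A) y e = 0.
  rewrite -sum_coboundary; apply: big1 => t _; rewrite /coboundary.
  case: (boolP (t \in P)) => tP; last first.
    by apply: big_pred0 => e; rewrite /edge_inc (negbTE tP).
  have -> : \sum_(e | edge_inc P e t) y e =
      #|[set e : {set 'I_n} | [&& #|e| == 2%N, e \subset t & v \in e]]%SET|%:R.
    rewrite -sum1_card natr_sum big_mkcond [RHS]big_mkcond /=.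
    apply: eq_bigr => e _; rewrite inE /edge_inc tP /= /y.
    by case: (#|e| == 2%N); case: (e \subset t); case: (v \in e).
  case: (boolP (v \in t)) => vt; last first.
    rewrite (_ : [set _ | _]%SET = finset.set0) ?cards0 //.
    apply/finset.setP => e; rewrite !inE; apply/negbTE/negP => /and3P[_ et ve].
    by move: vt; rewrite (fintype.subsetP et).
  have tv : #|t :\ v| = 2%N.
    by have := cardsD1 v t; rewrite vt P3 // => -[].
  rewrite natr_F2; set B := [set _ | _]%SET.
  suff -> : #|B| = #|t :\ v| by rewrite tv.
  rewrite -(@card_in_imset _ _ (fun w => [set v; w]%SET)); last first.
    move=> w w'; rewrite !inE => /andP[wv _] /andP[wv' _] /finset.setP/(_ w).
    by rewrite !inE eqxx orbT (negbTE wv) /= => /esym/eqP.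
  apply: eq_card => e; rewrite !inE; apply/and3P/imsetP => [[e2 et ve]|].
    have /cards1P[w wE] : #|e :\ v| == 1%N.
      by have := cardsD1 v e; rewrite ve (eqP e2); lia.
    have we : w \in (e :\ v)%SET by rewrite wE inE.
    move: we; rewrite !inE => /andP[wv we].
    exists w; first by rewrite !inE wv (fintype.subsetP et).
    by rewrite -(finset.setD1K ve) wE.
  case=> w; rewrite !inE => /andP[wv wt] ->; split.
  - by rewrite cards2 [v == w]eq_sym wv.
  - by apply/fintype.subsetP => u; rewrite !inE => /orP[] /eqP ->.
  - by rewrite !inE eqxx.
rewrite /y -natr_sum => E0.
have : (#|[set e in cell_bd (edge_inc P) A | v \in e]%SET|%:R : 'F_2) = 0.
  rewrite -[RHS]E0; congr (_%:R); rewrite -sum1_card big_mkcond [RHS]big_mkcond.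
  by apply: eq_bigr => e _; rewrite !inE; case: odd; case: (v \in e).
by rewrite natr_F2; case: odd.
Qed.

(* The last hypothesis is the vanishing of the first cohomology mod 2 as seen
   from [G].  It gives Euler's inequality [|G| <= |V| + F], and [3 F <= 2 |G|]
   for the number [F] of closed faces. *)
Lemma planar_edge_bound n (P G : {set {set 'I_n}}) :
  (forall t, t \in P -> #|t| = 3%N) -> (forall e, e \in G -> #|e| = 2%N) ->
  (forall e : {set 'I_n}, #|e| = 2%N -> (#|[set t in P | e \subset t]| <= 2)%N) ->
  (forall y : {set 'I_n} -> 'F_2,
     (forall t, coboundary (edge_inc P) y t = 0) ->
     exists phi : 'I_n -> 'F_2, forall a b, a != b -> [set a; b]%SET \in G ->
       y [set a; b]%SET = phi a + phi b) ->
  (#|G| <= 3 * #|finset.cover G|)%N.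
Proof.
move=> P3 G2 inc2 H1.
have inc2' e : (#|[set w | edge_inc P e w]| <= 2)%N.
  case: (eqVneq #|e| 2%N) => [e2|e2]; last first.
    rewrite (_ : [set _ | _]%SET = finset.set0) ?cards0 //.
    by apply/finset.setP => t; rewrite !inE /edge_inc (negbTE e2) andbF.
  apply: leq_trans (inc2 _ e2).
  apply/subset_leq_card/fintype.subsetP => t; rewrite !inE /edge_inc.
  by move=> /and3P[-> _ ->].
have faces3 : (3 * #|closed_faces (edge_inc P) G| <= 2 * #|G|)%N.
  apply: card_closed_faces => // A; apply: even_degrees_card.
    move=> e; rewrite inE => oe; set B := [set _ in _ | _]%SET in oe.
    have /card_gt0P[t] : (0 < #|B|)%N by case: #|B| oe.
    by rewrite inE => /and4P[_ _ /eqP].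
  by move=> v; apply: cell_bd_even.
suff : (#|G| <= #|finset.cover G| + #|closed_faces (edge_inc P) G|)%N by lia.
(* The matrix [b] tests sums around closed faces and [a] is the incidence of vertices and edges. A
   cochain passing the tests extends to a cocycle, which is a coboundary on [G]. *)
apply: (card_le_of_ker_sub_im
  (b := fun e r => (e \in cell_bd (edge_inc P) (face_of (edge_inc P) G r))%:R)
  (a := fun v e => (v \in e)%:R)) => y yG yQ.
have [y' [y'G y'0]] := extend_cocycle inc2' yG yQ.
have [phi phiE] := H1 y' y'0; exists phi => e eG.
have /eqP/cards2P[a [b [ab eE]]] := G2 e eG.
rewrite -y'G // eE phiE -?eE //.
have eV v : v \in e -> v \in finset.cover G.
  by move=> ve; apply/bigcupP; exists e.
rewrite (bigD1 a) /=; last by rewrite eV // eE !inE eqxx.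
rewrite (bigD1 b) /=; last by rewrite eq_sym ab eV // eE !inE eqxx orbT.
rewrite big1 ?addr0; first by rewrite eE !inE !eqxx orbT !mulr1.
move=> v /andP[/andP[_ va] vb].
by rewrite eE !inE (negbTE va) (negbTE vb) mulr0.
Qed.

(** * Contraction of a punctured sphere *)

Local Open Scope classical_set_scope.

Lemma cvg_mx_coord (R : realType) (I : Type) (F : set_system I) m n
    (f : I -> 'M[R]_(m, n)) (M : 'M[R]_(m, n)) :
  Filter F ->
  (forall i j, (fun x => f x i j) @ F --> M i j) -> f @ F --> M.
Proof.
move=> FF cf U [P nP sPU]; apply: (filterS (P := fun x =>
  forall i j, P i j (f x i j))); first by move=> x; exact: sPU.
apply: filter_forall => i; apply: filter_forall => j.
exact: cf (nP i j).
Qed.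

Lemma within_continuous_comp (X Y Z : topologicalType) (A : set X) (B : set Y)
    (f : X -> Y) (g : Y -> Z) :
  {within A, continuous f} -> {within B, continuous g} ->
  (forall x, A x -> B (f x)) -> {within A, continuous (g \o f)}.
Proof.
move=> /subspace_continuousP cf /subspace_continuousP cg AB.
apply/subspace_continuousP => x Ax U /(cg _ (AB _ Ax)) gU.
have {}gU : nbhs (f x) [set y | B y -> U (g y)] := gU.
have fU : nbhs x [set z | A z -> B (f z) -> U (g (f z))] := cf _ Ax _ gU.
change (nbhs x [set z | A z -> U (g (f z))]).
by apply: filterS fU => z h Az; exact: h (AB z Az).
Qed.

Lemma within_continuous_coord (R : realType) (X : topologicalType) (A : set X) m n
    (f : X -> 'M[R]_(m, n)) :
  {within A, continuous f} <->
  forall i j, {within A, continuous (fun x => f x i j)}.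
Proof.
split=> [cf i j|cf].
  pose coord (M : 'M[R]_(m, n)) := M i j.
  have ccoord : {within setT, continuous coord}.
    by apply: continuous_subspaceT => M; exact: coord_continuous.
  exact: (within_continuous_comp cf ccoord).
apply/subspace_continuousP => x Ax; apply: cvg_mx_coord => i j.
by have /subspace_continuousP := cf i j; apply.
Qed.

(** Radial projection to the unit sphere, meaningful away from the origin. *)
Definition normalize (R : realType) (u : 'rV[R]_3) : 'rV[R]_3 :=
  (Num.sqrt (\sum_i u 0 i ^+ 2))^-1 *: u.

Lemma normalize_sphere (R : realType) (u : 'rV[R]_3) :
  \sum_i u 0 i ^+ 2 != 0 -> sphere2 (normalize u).
Proof.
move=> u0; rewrite /sphere2 /=.
under eq_bigr => i _ do rewrite mxE exprMn.
rewrite -mulr_sumr exprVn sqr_sqrtr ?mulVf //.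
by apply: sumr_ge0 => i _; exact: sqr_ge0.
Qed.

Lemma normalize_id (R : realType) (u : 'rV[R]_3) :
  sphere2 u -> normalize u = u.
Proof. by rewrite /sphere2 /normalize /= => ->; rewrite sqrtr1 invr1 scale1r. Qed.

Lemma within_continuous_normalize (R : realType) (X : topologicalType)
    (A : set X) (f : X -> 'rV[R]_3) :
  {within A, continuous f} -> (forall x, A x -> \sum_i f x 0 i ^+ 2 != 0) ->
  {within A, continuous (fun x => normalize (f x))}.
Proof.
move=> /within_continuous_coord cf f0.
apply/within_continuous_coord => i j.
rewrite (_ : (fun _ => _) =
    (fun z : X => (Num.sqrt (\sum_k f z 0 k ^+ 2))^-1 * f z i j)); last first.
  by apply/funext => z; rewrite mxE.
apply/subspace_continuousP => x Ax.
have cfij k l : f z k l @[z --> within A (nbhs x)] --> f x k l.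
  by have /subspace_continuousP := cf k l; apply.
have sq0 : Num.sqrt (\sum_k f x 0 k ^+ 2) != 0.
  rewrite sqrtr_eq0 -ltNge lt_neqAle eq_sym f0 //=.
  by apply: sumr_ge0 => k _; exact: sqr_ge0.
apply: cvgM (cfij i j); apply: cvgV => //.
apply: (@continuous_cvg _ _ _ _ _ _ (@Num.sqrt R)); first exact: sqrt_continuous.
apply: cvg_big => [|k _]; first exact: add_continuous.
by rewrite expr2; apply: cvgM.
Qed.

(* Slide along the great circles through [p]: the segment from [x <> p] to the
   antipode of [p] misses the origin. *)
Lemma sphere_contraction (R : realType) n (L : {set {set 'I_n}}) (p : 'rV[R]_n) :
  homeomorphic (@realization R n L) (@sphere2 R) -> @realization R n L p ->
  exists (H : R * 'rV[R]_n -> 'rV[R]_n) (b : 'rV[R]_n),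
    let A := [set z : R * 'rV[R]_n |
               [/\ 0 <= z.1 <= 1, @realization R n L z.2 & z.2 <> p]] in
    [/\ {within A, continuous H},
        forall z, A z -> @realization R n L (H z) /\ H z <> p,
        forall x, @realization R n L x -> x <> p -> H (0, x) = x &
        forall x, H (1, x) = b].
Proof.
move=> [f [g [cf cg fg gf]]] Lp; pose c := f p.
pose w (z : R * 'rV[R]_n) := (1 - z.1) *: f z.2 - z.1 *: c.
pose A := [set z : R * 'rV[R]_n |
               [/\ 0 <= z.1 <= 1, @realization R n L z.2 & z.2 <> p]].
have Sc : sphere2 c by have [] := fg _ Lp.
(* Distinct unit vectors span distinct rays. This serves twice: the segment misses the origin, and
   its radial projection misses [c]. *)
have collinear x (a b : R) : @realization R n L x -> x <> p -> 0 <= a -> 0 <= b ->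
    a *: f x = b *: c -> a = 0 /\ b = 0.
  move=> Lx xp a0 b0 /rowP ab; have [Sfx gfx] := fg _ Lx.
  have : a ^+ 2 = b ^+ 2.
    rewrite -[LHS]mulr1 -[RHS]mulr1 -{1}Sfx -Sc !mulr_sumr.
    by apply: eq_bigr => i _; have := ab i; rewrite !mxE -!exprMn => ->.
  move/eqP; rewrite eqrXn2 // => /eqP aE; case: (eqVneq b 0) => [b1|b1].
    by rewrite aE b1.
  case: xp; rewrite -gfx; have [_ <-] := fg _ Lp; congr g; apply/rowP => i.
  by have := ab i; rewrite !mxE aE => /(mulfI b1).
have w0 z : A z -> \sum_i w z 0 i ^+ 2 != 0.
  case=> /andP[s0 s1] Lx xp; apply/eqP => E0.
  have wi i : w z 0 i = 0.
    apply/eqP; rewrite -sqrf_eq0; apply/eqP; move: i isT.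
    by apply: psumr_eq0P E0 => i _; exact: sqr_ge0.
  have [|||/eqP E1 E2] := collinear z.2 (1 - z.1) z.1 Lx xp; rewrite ?subr_ge0 //.
    apply/rowP => i; have := wi i; rewrite !mxE => /eqP.
    by rewrite subr_eq0 => /eqP.
  by move: E1; rewrite E2 subr0 oner_eq0.
have cfst : {within A, continuous (fun z => z.1)}.
  by apply: continuous_subspaceT => z; exact: cvg_fst.
have cw : {within A, continuous w}.
  apply/within_continuous_coord => i j.
  rewrite (_ : (fun _ => _) =
      (fun y : R * 'rV[R]_n => (1 - y.1) * f y.2 i j - y.1 * c i j)); last first.
    by apply/funext => y; rewrite !mxE.
  apply/subspace_continuousP => z Az.
  have c1 : y.1 @[y --> within A (nbhs z)] --> z.1.
    by have /subspace_continuousP := cfst; apply.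
  have c2 : (f y.2) i j @[y --> within A (nbhs z)] --> (f z.2) i j.
    have : {within A, continuous (f \o snd)}.
      apply: within_continuous_comp cf _; last by move=> ? [].
      by apply: continuous_subspaceT => y; exact: cvg_snd.
    by move/within_continuous_coord => /(_ i j) /subspace_continuousP; apply.
  apply: cvgB; apply: cvgM => //; last exact: cvg_cst.
  by apply: cvgB => //; exact: cvg_cst.
exists (fun z => g (normalize (w z))), (g (normalize (- c))); split.
- apply: (within_continuous_comp _ cg); last first.
    by move=> z Az; apply: normalize_sphere; exact: w0.
  exact: within_continuous_normalize.
- move=> z Az; have [Lg fgw] := gf _ (normalize_sphere (w0 _ Az)); split=> // gp.
  case: (Az) => /andP[s0 s1] Lx xp.
  pose k := (Num.sqrt (\sum_i w z 0 i ^+ 2))^-1.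
  have k0 : 0 < k.
    rewrite invr_gt0 sqrtr_gt0 lt_neqAle eq_sym w0 //=.
    by apply: sumr_ge0 => i _; exact: sqr_ge0.
  (* If the projection were [c], solving [k w = c] for the multiple of [f z.2] would give these
     coefficients, of which the second is positive. *)
  have [|||E1 E2] := collinear z.2 (k * (1 - z.1)) (1 + k * z.1) Lx xp.
  + by rewrite mulr_ge0 ?subr_ge0 // ltW.
  + by rewrite addr_ge0 // mulr_ge0 // ltW.
  + move: fgw; rewrite gp -/c => fgw.
    rewrite [in RHS]scalerDl scale1r {1}fgw.
    rewrite /normalize -/k /w scalerBr !scalerA -addrA [- _ + _]addrC.
    by rewrite subrr addr0.
  + have : 0 < 1 + k * z.1 by rewrite ltr_pwDl // mulr_ge0 // ltW.
    by rewrite E2 ltxx.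
- move=> x Lx xp; have [Sx gx] := fg _ Lx.
  by rewrite /w /= subr0 scale1r scale0r subr0 normalize_id.
- by move=> x; rewrite /w /= subrr scale0r sub0r scale1r.
Qed.

Definition unit_square (R : realType) : set (R * R) :=
  `[0, 1]%classic `*` `[0, 1]%classic.

(** Uniform continuity on a compact set, with the modulus expressed as the mesh of a grid. *)
Lemma square_uniform_continuous (R : realType) (u : R * R -> R) (e : R) :
  {within @unit_square R, continuous u} -> 0 < e ->
  \forall N \near \oo, forall z w : R * R,
    @unit_square R z -> @unit_square R w ->
    `|z.1 - w.1| <= N.+1%:R^-1 -> `|z.2 - w.2| <= N.+1%:R^-1 ->
    `|u z - u w| < e.
Proof.
set A := @unit_square R => /subspace_continuousP cu e0.
have cA : compact A by apply: compact_setX; exact: segment_compact.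
pose P (N : nat) (z : R * R) := A z -> forall w, A w ->
  `|z.1 - w.1| <= N.+1%:R^-1 -> `|z.2 - w.2| <= N.+1%:R^-1 -> `|u z - u w| < e.
suff : \forall N \near \oo, A `<=` P N.
  by apply: filterS => N AP z w Az Aw; exact: AP.
move/compact_near_coveringP: cA; apply => z0 Az0.
have e2 : 0 < e / 2 by rewrite divr_gt0.
have /cvgrPdist_lt/(_ _ e2) := cu _ Az0.
rewrite near_withinE => /nbhs_ballP[d /= d0 dP].
have d2 : 0 < d / 2 by rewrite divr_gt0.
(* With both radius and mesh at most [d / 2], the point [w] stays within [d] of [z0]. *)
exists (ball z0 (d / 2), [set N : nat | N.+1%:R^-1 < d / 2]).
  split; first exact: nbhsx_ballx.
  exact: near_infty_natSinv_lt (PosNum d2).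
move=> [z N] /= [[b1 b2] Nd] Az w Aw d1 d2'.
have bz : ball z0 d z.
  by split; [move: b1|move: b2]; apply: le_ball; move: d0; clear; lra.
have bw : ball z0 d w.
  split; rewrite -ball_normE /=; [move: b1|move: b2]; rewrite -ball_normE /= => b.
    rewrite -(subrK z.1 z0.1) -addrA (le_lt_trans (ler_normD _ _)) //.
    by rewrite [d]splitr ltrD // (le_lt_trans d1).
  rewrite -(subrK z.2 z0.2) -addrA (le_lt_trans (ler_normD _ _)) //.
  by rewrite [d]splitr ltrD // (le_lt_trans d2').
have h1 := dP _ bz Az; have h2 := dP _ bw Aw.
rewrite -(subrK (u z0) (u z)) -addrA (le_lt_trans (ler_normD _ _)) //.
by rewrite [e]splitr ltrD // distrC.
Qed.

(** * Cocycles on a triangulated sphere *)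

Lemma cocycle_refl n (L : {set {set 'I_n}}) (V : zmodType)
    (c : 'I_n -> 'I_n -> V) :
  (forall s x y z, s \in L -> x \in s -> y \in s -> z \in s ->
     c x y + c y z = c x z) ->
  forall s x, s \in L -> x \in s -> c x x = 0.
Proof.
move=> cc s x sL xs; have := cc s x x x sL xs xs xs.
by rewrite -[X in _ = X -> _]add0r => /addIr.
Qed.

(** Discrete Stokes on a grid: the cocycle relation cancels around every cell. The end [i = M] is
    constant and contributes nothing, while the end [i = 0] runs from [a] to [b] inside a single
    edge and contributes [c a b]. *)
Lemma grid_telescope n (L : {set {set 'I_n}}) (V : zmodType)
    (c : 'I_n -> 'I_n -> V) (m : nat -> nat -> 'I_n) (M : nat) a b :
  (forall s x y z, s \in L -> x \in s -> y \in s -> z \in s ->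
     c x y + c y z = c x z) ->
  (forall i j, (i < M)%N -> (j < M)%N -> exists2 s, s \in L &
     [/\ m i j \in s, m i.+1 j \in s, m i j.+1 \in s & m i.+1 j.+1 \in s]) ->
  (forall j, (j <= M)%N -> m M j = m M 0%N) ->
  (forall j, (j <= M)%N -> m 0%N j \in [set a; b]%SET) ->
  m 0%N 0%N = a -> m 0%N M = b -> [set a; b]%SET \in L -> (0 < M)%N ->
  c a b = \sum_(i < M) c (m i 0%N) (m i.+1 0%N)
          - \sum_(i < M) c (m i M) (m i.+1 M).
Proof.
move=> cc cell mM m0 ma mb abL M0.
have strip j : (j < M)%N -> forall k, (k <= M)%N ->
    \sum_(i < k) c (m i j) (m i.+1 j) + c (m k j) (m k j.+1) =
    c (m 0%N j) (m 0%N j.+1) + \sum_(i < k) c (m i j.+1) (m i.+1 j.+1).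
  move=> jM; elim=> [|k IHk] kM; first by rewrite !big_ord0 add0r addr0.
  have [s sL [s00 s10 s01 s11]] := cell k j kM jM.
  rewrite !big_ord_recr /= -addrA (cc s) // addrA -IHk 1?ltnW // -addrA.
  by rewrite (cc s).
have diag j : (j <= M)%N -> \sum_(i < M) c (m i 0%N) (m i.+1 0%N) =
    c a (m 0%N j) + \sum_(i < M) c (m i j) (m i.+1 j).
  elim: j => [|j IHj] jM.
    by rewrite ma (cocycle_refl cc abL) ?add0r // !inE eqxx.
  rewrite IHj 1?ltnW //; have := strip j jM M (leqnn M).
  (* The last cell provides a simplex containing the constant end vertex, where [c] vanishes on the
     diagonal. *)
  have [s sL [_ _ _ sM]] := cell M.-1 j ltac:(lia) jM.
  rewrite (mM j.+1) // -(mM j.+1) // (mM j) 1?ltnW // -(mM j.+1) //.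
  rewrite prednK // in sM.
  rewrite (cocycle_refl cc sL sM) addr0 => ->.
  by rewrite addrA (cc [set a; b]%SET) ?m0 ?(ltnW jM) // !inE eqxx.
by rewrite (diag M (leqnn M)) mb addrK.
Qed.

Lemma supp_gt0 (R : realType) n (L : {set {set 'I_n}}) (x : 'rV[R]_n) i :
  realization L x -> (i \in supp x) = (0 < x 0 i).
Proof. by case=> x0 _ _; rewrite inE lt_neqAle x0 andbT eq_sym. Qed.

Lemma sum_supp (R : realType) n (L : {set {set 'I_n}}) (x : 'rV[R]_n) :
  realization L x -> \sum_(i in supp x) x 0 i = 1.
Proof.
case=> _ <- _; rewrite big_mkcond; apply: eq_bigr => i _.
by rewrite inE; case: eqP => [->|].
Qed.

(** A maximal coordinate is at least the average of the coordinates. The bound does not depend on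
    the point, so it can be compared with a modulus of uniform continuity. *)
Lemma max_coord (R : realType) n (L : {set {set 'I_n}}) (i0 : 'I_n) :
  exists mv : 'rV[R]_n -> 'I_n,
    forall x, realization L x -> n%:R^-1 <= x 0 (mv x).
Proof.
exists (fun x => [arg max_(i > i0) x 0 i]%O) => x [x0 x1 _].
case: arg_maxP => // m _ mP.
have n0 : (0 < n)%N := leq_ltn_trans (leq0n _) (ltn_ord i0).
rewrite -(ler_pM2l (x := n%:R)) ?ltr0n // mulfV ?pnatr_eq0 -?lt0n //.
have -> : n%:R * x 0 m = \sum_(i < n) x 0 m.
  by rewrite sumr_const card_ord mulr_natl.
rewrite -[leLHS]x1.
by apply: ler_sum => i _; exact: mP.
Qed.

Lemma supp_segment (R : realType) n (a b : 'I_n) (t : R) :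
  supp ((1 - t) *: delta_mx 0 a + t *: delta_mx 0 b : 'rV[R]_n)
    \subset [set a; b]%SET.
Proof.
apply/fintype.subsetP => i; rewrite !inE !mxE eqxx /=; apply: contraNT.
by rewrite negb_or => /andP[/negbTE -> /negbTE ->]; rewrite !mulr0 addr0.
Qed.

Lemma realization_segment (R : realType) n (L : {set {set 'I_n}}) (a b : 'I_n)
    (t : R) :
  (forall s t : {set 'I_n}, s \in L -> t \subset s -> t != finset.set0 -> t \in L) ->
  [set a; b]%SET \in L -> 0 <= t <= 1 ->
  realization L ((1 - t) *: delta_mx 0 a + t *: delta_mx 0 b : 'rV[R]_n).
Proof.
move=> Ldown abL /andP[t0 t1]; set x := (_ + _).
have x1 : \sum_i x 0 i = 1.
  rewrite /x; under eq_bigr => i _ do rewrite !mxE eqxx /=.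
  rewrite big_split /= -!mulr_sumr.
  have sum1 (c : 'I_n) : \sum_(i < n) (i == c)%:R = 1 :> R.
    by rewrite (bigD1 c) //= eqxx big1 ?addr0 // => i /negbTE ->.
  by rewrite !sum1 !mulr1 subrK.
split=> // [i|].
  by rewrite !mxE addr_ge0 // mulr_ge0 // ?subr_ge0 // ler0n.
apply: Ldown abL (supp_segment _ _ _) _.
apply/eqP => s0; move: x1; rewrite big1; first by move=> /esym/eqP; rewrite oner_eq0.
move=> i _; apply/eqP; move/finset.setP/(_ i): s0; rewrite !inE.
by move/negbFE.
Qed.

(* Discretize the cone over each edge on a fine grid of the square and replace
   each point by a vertex with coordinate at least [1/n]: nearby points then get
   vertices of a common simplex, so the cocycle telescopes. *)
Lemma sphere_cocycle_exact (R : realType) n (L : {set {set 'I_n}})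
    (p : 'rV[R]_n) (V : zmodType) (c : 'I_n -> 'I_n -> V) :
  (forall s t : {set 'I_n}, s \in L -> t \subset s -> t != finset.set0 -> t \in L) ->
  homeomorphic (@realization R n L) (@sphere2 R) ->
  realization L p -> (2 < #|supp p|)%N ->
  (forall s x y z, s \in L -> x \in s -> y \in s -> z \in s ->
     c x y + c y z = c x z) ->
  exists phi : 'I_n -> V,
    forall a b, [set a; b]%SET \in L -> c a b = phi a - phi b.
Proof.
move=> Ldown LS Lp p3 cc.
have [i0 _] : exists i, i \in supp p.
  by apply/card_gt0P; apply: leq_trans p3.
have [H [base [cH HL H0 H1]]] := sphere_contraction LS Lp.
have [mv mvP] := max_coord R L i0.
have n0 : 0 < (n%:R^-1 : R).
  by rewrite invr_gt0 ltr0n; exact: leq_ltn_trans (leq0n _) (ltn_ord i0).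
pose gam (a b : 'I_n) (t : R) : 'rV[R]_n :=
  (1 - t) *: delta_mx 0 a + t *: delta_mx 0 b.
(* The puncture [p] has at least three nonzero coordinates, so no edge passes through it. *)
have gamL a b t : [set a; b]%SET \in L -> 0 <= t <= 1 ->
    realization L (gam a b t) /\ gam a b t <> p.
  move=> abL t01; split; first exact: realization_segment.
  move=> gp; have := subset_leq_card (supp_segment a b t).
  by rewrite -/(gam a b t) gp cards2 leqNgt; case: (a != b); rewrite ?p3 ?(ltnW p3).
pose F a b (z : R * R) := H (z.1, gam a b z.2).
have sqP z : @unit_square R z <-> 0 <= z.1 <= 1 /\ 0 <= z.2 <= 1.
  by rewrite /unit_square /setX /= !in_itv.
have FL a b z : [set a; b]%SET \in L -> @unit_square R z -> realization L (F a b z).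
  move=> abL /sqP[z1 z2]; have [gL gp] := gamL a b _ abL z2.
  by have [] := HL (z.1, gam a b z.2).
have cF a b k : [set a; b]%SET \in L ->
    {within @unit_square R, continuous (fun z => F a b z 0 k)}.
  move=> abL; have : {within @unit_square R, continuous (F a b)}.
    apply: (within_continuous_comp (f := fun z : R * R => (z.1, gam a b z.2)) _ cH).
      apply: continuous_subspaceT => z.
      have c1 : y.1 @[y --> z] --> z.1 by exact: cvg_fst.
      have c2 : y.2 @[y --> z] --> z.2 by exact: cvg_snd.
      have cg : gam a b y.2 @[y --> z] --> gam a b z.2.
        apply: cvgD; apply: cvgZ => //; try exact: cvg_cst.
        by apply: cvgB => //; exact: cvg_cst.
      exact: (cvg_pair c1 cg).
    by move=> z /sqP[z1 z2] /=; have [] := gamL a b z.2 abL z2.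
  by move/within_continuous_coord; apply.
have : \forall N \near \oo, forall a b k, [set a; b]%SET \in L ->
    forall z w : R * R, @unit_square R z -> @unit_square R w ->
    `|z.1 - w.1| <= N.+1%:R^-1 -> `|z.2 - w.2| <= N.+1%:R^-1 ->
    `|F a b z 0 k - F a b w 0 k| < n%:R^-1.
  apply: filter_forall => a; apply: filter_forall => b; apply: filter_forall => k.
  case: (boolP ([set a; b]%SET \in L)) => abL; last by apply: nearW.
  apply: filterS (square_uniform_continuous (cF a b k abL) n0) => N h _ z w.
  exact: h.
case=> N _ /(_ N (leqnn N)) NP.
pose M := N.+1; pose pt (i j : nat) : R * R := (i%:R / M%:R, j%:R / M%:R).
have M0 : 0 < M%:R :> R by rewrite ltr0n.
have ptI i : (i <= M)%N -> 0 <= (i%:R / M%:R : R) <= 1.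
  by move=> iM; rewrite divr_ge0 //= ler_pdivrMr // mul1r ler_nat.
have ptS i : `|i.+1%:R / M%:R - i%:R / M%:R| <= M%:R^-1 :> R.
  by rewrite -mulrBl -natr1 addrAC subrr add0r mul1r ger0_norm // invr_ge0 ltW.
have ptS' i : `|i%:R / M%:R - i.+1%:R / M%:R| <= M%:R^-1 :> R by rewrite distrC.
have pt0 i : `|i%:R / M%:R - i%:R / M%:R| <= M%:R^-1 :> R.
  by rewrite subrr normr0 invr_ge0 ltW.
(* The chosen coordinate is at least [1/n] at [w] and changes by less than [1/n], hence is positive
   at [z]. All corners of a grid cell thus receive vertices of the support at one corner. *)
have mvF a b z w : [set a; b]%SET \in L -> @unit_square R z -> @unit_square R w ->
    `|z.1 - w.1| <= M%:R^-1 -> `|z.2 - w.2| <= M%:R^-1 ->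
    mv (F a b w) \in supp (F a b z).
  move=> abL Az Aw d1 d2; rewrite (supp_gt0 _ (FL _ _ _ abL Az)).
  have := NP a b (mv (F a b w)) abL z w Az Aw d1 d2.
  have := mvP _ (FL _ _ _ abL Aw); rewrite ltr_norml => h1 /andP[h2 _]; lra.
(* The primitive at [v] sums [c] along the discretized track of [v] under the contraction. *)
exists (fun v => \sum_(i < M) c (mv (H (i%:R / M%:R, delta_mx 0 v)))
                              (mv (H (i.+1%:R / M%:R, delta_mx 0 v)))) => a b abL.
have gam0 : gam a b 0 = delta_mx 0 a.
  by rewrite /gam subr0 scale1r scale0r addr0.
have gam1 : gam a b 1 = delta_mx 0 b.
  by rewrite /gam subrr scale0r scale1r add0r.
have ptA i j : (i <= M)%N -> (j <= M)%N -> @unit_square R (pt i j).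
  by move=> iM jM; apply/sqP; split; exact: ptI.
pose m i j := mv (F a b (pt i j)).
have m0 j : (j <= M)%N -> m 0%N j \in supp (gam a b (j%:R / M%:R)).
  move=> jM; have [gL gp] := gamL a b _ abL (ptI j jM).
  rewrite /m /F /= mul0r H0 // (supp_gt0 _ gL).
  exact: lt_le_trans n0 (mvP _ gL).
have vert v j : (j <= M)%N -> gam a b (j%:R / M%:R) = delta_mx 0 v -> m 0%N j = v.
  move=> jM gv; have := m0 j jM; rewrite gv inE mxE eqxx /=.
  by case: (m 0%N j =P v) => //= _; rewrite eqxx.
have colE v j : gam a b (j%:R / M%:R) = delta_mx 0 v ->
    \sum_(i < M) c (mv (H (i%:R / M%:R, delta_mx 0 v)))
                   (mv (H (i.+1%:R / M%:R, delta_mx 0 v))) =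
    \sum_(i < M) c (m i j) (m i.+1 j).
  by rewrite /m /F /= => ->.
rewrite (colE a 0%N) ?mul0r // (colE b M) ?mulfV ?gt_eqF //.
apply: (grid_telescope cc) => //.
- move=> i j iM jM; have Aij := ptA i j (ltnW iM) (ltnW jM).
  exists (supp (F a b (pt i j))); first by have [] := FL a b _ abL Aij.
  split; apply: mvF => //=; do ?[exact: ptS|exact: ptS'|exact: pt0|exact: ptA].
  + exact: ptA iM (ltnW jM).
  + exact: ptA (ltnW iM) jM.
- by move=> j jM; rewrite /m /F /= mulfV ?gt_eqF // !H1.
- by move=> j jM; exact: (fintype.subsetP (supp_segment _ _ _) _ (m0 j jM)).
- by apply: (vert a 0%N) => //; rewrite mul0r.
- by apply: (vert b M) => //; rewrite mulfV // gt_eqF.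
Qed.

(** The signed sum [q] of the coordinates off [y] does not vanish away from the vertex [y], since
    [phi] is constant on each simplex off [y]. Along the contraction [q] keeps its sign by the
    intermediate value theorem, so each [phi a] is the sign of [q] at the base point. *)
Lemma sphere_minus_vertex_connected (R : realType) n (L : {set {set 'I_n}})
    (y : 'I_n) (phi : 'I_n -> bool) :
  (forall s t : {set 'I_n}, s \in L -> t \subset s -> t != finset.set0 -> t \in L) ->
  homeomorphic (@realization R n L) (@sphere2 R) -> [set y]%SET \in L ->
  (forall a b, [set a; b]%SET \in L -> a != y -> b != y -> phi a = phi b) ->
  forall a b, [set a]%SET \in L -> [set b]%SET \in L -> a != y -> b != y ->
    phi a = phi b.
Proof.
move=> Ldown LS yL phiE.
have vert v : [set v]%SET \in L -> realization L (delta_mx 0 v : 'rV[R]_n).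
  move=> vL; have := @realization_segment R n L v v 0 Ldown.
  by rewrite finset.setUid lexx ler01 subr0 scale1r scale0r addr0; apply.
have [H [base [cH HL H0 H1]]] := sphere_contraction LS (vert y yL).
pose q (x : 'rV[R]_n) := \sum_(v | v != y) (if phi v then x 0 v else - x 0 v).
have q0 x : realization L x -> x <> delta_mx 0 y -> q x != 0.
  move=> Lx xy; have [x0 x1 xs] := Lx.
  have [v [vy vx]] : exists v, v != y /\ 0 < x 0 v.
    apply: contrapT => nv; apply: xy; have z v : v != y -> x 0 v = 0.
      move=> vy; apply/eqP; rewrite eq_le x0 andbT leNgt; apply/negP => vx.
      by apply: nv; exists v.
    apply/rowP => i; rewrite mxE eqxx /=; case: eqP => [->|/eqP/z //].
    by rewrite -x1 (bigD1 y) //= big1 ?addr0.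
  have same w : w != y -> x 0 w != 0 -> phi w = phi v.
    move=> wy wx; apply: phiE => //; apply: Ldown xs _ _.
      apply/fintype.subsetP => i; rewrite !inE => /orP[] /eqP -> //.
      by rewrite gt_eqF.
    by apply/set0Pn; exists w; rewrite !inE eqxx.
  have pos : 0 < \sum_(w | w != y) x 0 w.
    by rewrite (bigD1 v) //= ltr_pwDl // sumr_ge0.
  have -> : q x = if phi v then \sum_(w | w != y) x 0 w
                 else - \sum_(w | w != y) x 0 w.
    rewrite /q -sumrN; case: ifP => pv; apply: eq_bigr => w wy;
      case: (eqVneq (x 0 w) 0) => [->|/(same _ wy) ->]; rewrite ?pv ?oppr0 ?if_same //.
  by case: ifP => _; rewrite ?oppr_eq0 gt_eqF.
have qv v : v != y -> q (delta_mx 0 v) = if phi v then 1 else -1.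
  move=> vy; rewrite /q (bigD1 v) //= mxE !eqxx /= big1 ?addr0 // => w /andP[_ wv].
  by rewrite mxE eqxx (negbTE wv) /= oppr0 if_same.
suff key a : [set a]%SET \in L -> a != y -> phi a = (0 < q base).
  by move=> a b aL bL ay by_; rewrite !key.
move=> aL ay; have Lab := vert a aL.
have aNy : delta_mx 0 a <> delta_mx 0 y :> 'rV[R]_n.
  move/rowP/(_ a)/eqP; rewrite !mxE !eqxx (negbTE ay) /= oner_eq0 //.
pose h (s : R) := q (H (s, delta_mx 0 a)).
have ch : {within `[0, 1], continuous h}.
  have cHa : {within `[0, 1], continuous (fun s : R => H (s, delta_mx 0 a))}.
    apply: (within_continuous_comp 
      (f := fun s : R => (s, delta_mx 0 a : 'rV[R]_n)) _ cH).
      apply: continuous_subspaceT => s.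
      have c1 : y @[y --> s] --> s by exact: cvg_id.
      have c2 : (delta_mx 0 a : 'rV[R]_n) @[_ --> s] --> (delta_mx 0 a : 'rV[R]_n).
        exact: cvg_cst.
      exact: (cvg_pair c1 c2).
    by move=> s; rewrite /= in_itv.
  apply/subspace_continuousP => s s01; apply: cvg_big => [|v _].
    exact: add_continuous.
  move/within_continuous_coord/(_ 0 v)/subspace_continuousP/(_ s s01): cHa => cv.
  by case: (phi v) => //; exact: cvgN.
have h0 s : 0 <= s <= 1 -> h s != 0.
  by move=> s01; have [|Lh hy] := HL (s, delta_mx 0 a); [split|exact: q0].
have hb : h 1 = q base by rewrite /h H1.
have ha : h 0 = if phi a then 1 else -1 by rewrite /h H0 // qv.
apply: contrapT => ne; have [] := @IVT R h 0 1 0 ler01 ch.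
  have := h0 1; rewrite ler01 lexx hb => /(_ isT) b0.
  rewrite ha ge_min le_max; case: (phi a) ne => ne.
    have qb : q base <= 0 by rewrite leNgt; apply/negP => qb; apply: ne; rewrite qb.
    by rewrite qb orbT ler01.
  have qb : 0 < q base by case: ltP ne.
  by rewrite lerN10 (ltW qb) orbT.
by move=> s; rewrite in_itv => /h0 /eqP.
Qed.

Local Close Scope classical_set_scope.

(** * Links of vertices and edges *)

Lemma link_down n (K : {set {set 'I_n}}) (x : 'I_n) :
  simplicial_complex K ->
  forall s t : {set 'I_n}, s \in link K x -> t \subset s -> t != finset.set0 ->
    t \in link K x.
Proof.
move=> Ksc s t; rewrite !inE => /and3P[s0 xs xsK] ts ->.
have [_ /(_ (x |: t)%SET)] := Ksc _ xsK.
rewrite (finset.setUS _ ts) => -> //; last first.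
  by apply/set0Pn; exists x; rewrite !inE eqxx.
by rewrite andbT; apply: contra xs; apply: (fintype.subsetP ts).
Qed.

Lemma barycenter (R : realType) n (L : {set {set 'I_n}}) (t : {set 'I_n}) :
  t \in L -> t != finset.set0 ->
  exists2 p : 'rV[R]_n, realization L p & supp p = t.
Proof.
move=> tL t0; pose p : 'rV[R]_n := \row_i (if i \in t then #|t|%:R^-1 else 0).
have c0 : #|t|%:R != 0 :> R by rewrite pnatr_eq0 cards_eq0.
have sp : supp p = t.
  apply/finset.setP => i; rewrite inE mxE; case: ifP => _; last by rewrite eqxx.
  by rewrite invr_eq0.
exists p => //; split; last by rewrite sp.
  by move=> i; rewrite mxE; case: ifP => // _; rewrite invr_ge0 ler0n.
under eq_bigr => i _ do rewrite mxE.
by rewrite -big_mkcond /= sumr_const -[LHS]mulr_natl mulfV.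
Qed.

(** The barycentre of the triangle opposite to [x] serves as the puncture for contracting the edges
    of the link. *)
Lemma link_point (R : realType) n (K : {set {set 'I_n}}) (s : {set 'I_n}) x :
  s \in K -> #|s| = 4%N -> x \in s ->
  exists2 p : 'rV[R]_n, realization (link K x) p & (2 < #|supp p|)%N.
Proof.
move=> sK s4 xs; have c3 : #|s :\ x| = 3%N.
  by have := cardsD1 x s; rewrite xs s4; lia.
have t0 : (s :\ x != finset.set0)%SET by rewrite -cards_eq0 c3.
have [|p Lp sp] := @barycenter R n (link K x) _ _ t0.
  by rewrite inE t0 !inE eqxx finset.setD1K.
by exists p; rewrite ?sp ?c3.
Qed.

Lemma triangle_edge_sum n (P : {set {set 'I_n}}) (y : {set 'I_n} -> 'F_2) a b c :
  a != b -> b != c -> a != c -> [set a; b; c]%SET \in P ->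
  coboundary (edge_inc P) y [set a; b; c]%SET =
  y [set a; b]%SET + y [set b; c]%SET + y [set a; c]%SET.
Proof.
move=> ab bc ac tP.
have cNab : c \notin [set a; b]%SET by rewrite !inE negb_or ![c == _]eq_sym ac.
have aNbc : a \notin [set b; c]%SET by rewrite !inE negb_or ab.
have bNac : b \notin [set a; c]%SET by rewrite !inE negb_or [b == a]eq_sym ab.
have ab_bc : [set b; c]%SET != [set a; b]%SET.
  by apply: contraNneq cNab => <-; rewrite !inE eqxx orbT.
have ab_ac : [set a; c]%SET != [set a; b]%SET.
  by apply: contraNneq cNab => <-; rewrite !inE eqxx orbT.
have bc_ac : [set a; c]%SET != [set b; c]%SET.
  by apply: contraNneq aNbc => <-; rewrite !inE eqxx.
have incE e : edge_inc P e [set a; b; c]%SET =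
    (e \in [set [set a; b]; [set b; c]; [set a; c]]%SET).
  rewrite /edge_inc tP !inE /=; apply/andP/orP => [[/cards2P[u [v [uv ->]]]]|].
    move/fintype.subsetP => sub; have := sub u; have := sub v; rewrite !inE !eqxx.
    rewrite orbT /= => /(_ isT) hv /(_ isT) hu; move: uv.
    case/orP: hu => [/orP[]|] /eqP ->; case/orP: hv => [/orP[]|] /eqP ->;
      move=> uv; first [by rewrite eqxx in uv | clear uv];
      first [ by left; rewrite eqxx | by left; rewrite finset.setUC eqxx
            | by left; rewrite eqxx orbT | by left; rewrite finset.setUC eqxx orbT
            | by right; rewrite eqxx | by right; rewrite finset.setUC eqxx ].
  case=> [/orP[]|] /eqP ->; rewrite cards2 ?ab ?bc ?ac; split=> //;
    apply/fintype.subsetP => w; rewrite !inE => /orP[] ->; rewrite ?orbT //.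
rewrite /coboundary (eq_bigl _ _ incE).
rewrite (bigD1 [set a; b]%SET) /=; last by rewrite !inE eqxx.
rewrite (bigD1 [set b; c]%SET) /=; last by rewrite !inE eqxx orbT ab_bc.
rewrite (bigD1 [set a; c]%SET) /=; last by rewrite !inE eqxx orbT ab_ac bc_ac.
rewrite big1 ?addr0 ?addrA // => e.
by rewrite !inE => /andP[/andP[/andP[]]] /orP[/orP[]|] ->.
Qed.

Lemma link_cohomology (R : realType) n (K : {set {set 'I_n}}) (s : {set 'I_n}) x
    (y : {set 'I_n} -> 'F_2) :
  combinatorial_3manifold R K -> s \in K -> #|s| = 4%N -> x \in s ->
  (forall t, coboundary (edge_inc [set t in link K x | #|t| == 3%N]%SET) y t = 0) ->
  exists phi : 'I_n -> 'F_2, forall a b, a != b ->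
    [set a; b]%SET \in link K x -> y [set a; b]%SET = phi a + phi b.
Proof.
move=> [Ksc Klink] sK s4 xs y0; set L := link K x.
have Ldown := link_down (x := x) Ksc.
have xK : [set x]%SET \in K.
  have [_ ] := Ksc _ sK; apply; first by rewrite finset.sub1set.
  by apply/set0Pn; exists x; rewrite inE.
have [p Lp p3] := @link_point R n K s x sK s4 xs.
(* The value 0 on degenerate pairs makes the cocycle identity hold also when vertices coincide. *)
pose c a b : 'F_2 := if a == b then 0 else y [set a; b]%SET.
have [|phi phiE] := @sphere_cocycle_exact R n L p _ c Ldown (Klink _ xK) Lp p3.
  move=> t a b d tL at_ bt dt; rewrite /c.
  case: (eqVneq a b) => [->|ab]; first by rewrite add0r.
  case: (eqVneq b d) => [<-|bd]; first by rewrite (negbTE ab) addr0.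
  case: (eqVneq a d) => [<-|ad]; first by rewrite finset.setUC addrr_F2.
  have tri : [set a; b; d]%SET \in [set t in L | #|t| == 3%N]%SET.
    rewrite inE; apply/andP; split.
      apply: Ldown tL _ _; last by apply/set0Pn; exists a; rewrite !inE eqxx.
      by apply/fintype.subsetP => i; rewrite !inE => /orP[/orP[]|] /eqP ->.
    rewrite finset.setUC cardsU1 cards2 ab !inE negb_or ![d == _]eq_sym.
    by rewrite ad bd.
  have := y0 [set a; b; d]%SET; rewrite triangle_edge_sum // => /eqP.
  rewrite addr_eq0 => /eqP ->; apply/eqP; rewrite eq_sym -addr_eq0.
  by rewrite addrr_F2.
exists phi => a b ab abL; have := phiE a b abL; rewrite /c (negbTE ab) => ->.
congr (_ + _); apply/eqP; rewrite eq_sym -addr_eq0; apply/eqP; exact: addrr_F2.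
Qed.

(** Three triangles at [e] would give three tetrahedra on the triangle [x |: e], inducing pairwise
    different signs on it, but there are only two signs. *)
Lemma link_edge_two_triangles n (K : {set {set 'I_n}}) (x : 'I_n) (e : {set 'I_n}) :
  orientable_3complex K -> #|e| = 2%N ->
  (#|[set t in [set t in link K x | #|t| == 3%N] | e \subset t]| <= 2)%N.
Proof.
move=> [o oP] e2; rewrite leqNgt; apply/negP => /card_gt2P[t1 [t2 [t3 [[]]]]].
rewrite !inE => /andP[/andP[/and3P[_ x1 k1] /eqP c1] e1].
move=> /andP[/andP[/and3P[_ x2 k2] /eqP c2] e2'].
move=> /andP[/andP[/and3P[_ x3 k3] /eqP c3] e3] [n12 n23 n31].
have capE (t u : {set 'I_n}) : #|t| = 3%N -> #|u| = 3%N -> e \subset t ->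
    e \subset u -> t != u -> (x |: t) :&: (x |: u) = (x |: e) :> {set 'I_n}.
  move=> ct cu et eu tu; rewrite -finset.setUIr; congr (_ :|: _)%SET.
  apply/esym/eqP; rewrite eqEcard finset.subsetI et eu e2 /=.
  have : (t :&: u \proper t)%SET.
    rewrite properE finset.subsetIl /=; apply: contra tu => /finset.subsetIP[_ s].
    by rewrite eqEcard s ct cu.
  by move/proper_card; rewrite ct.
have card4 (t : {set 'I_n}) : x \notin t -> #|t| = 3%N -> #|(x |: t)%SET| = 4%N.
  by move=> xt ct; rewrite cardsU1 xt ct.
have xe : x \notin e by apply: contra x1; apply: (fintype.subsetP e1).
have o12 := oP _ _ k1 k2 (card4 _ x1 c1) (card4 _ x2 c2).
have o23 := oP _ _ k2 k3 (card4 _ x2 c2) (card4 _ x3 c3).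
have o31 := oP _ _ k3 k1 (card4 _ x3 c3) (card4 _ x1 c1).
rewrite !capE // in o12 o23 o31; rewrite cardsU1 xe e2 in o12 o23 o31.
move: (o12 erefl) (o23 erefl) (o31 erefl).
by do 3 case: (_ (+) _).
Qed.

(* A splitting of the neighbours of [y] gives a cocycle supported on the edges
   from [y] to one part.  A primitive of it is constant off [y], because a
   sphere minus a point is connected, so one of the parts is empty. *)
Lemma edge_link_connected (R : realType) n (K : {set {set 'I_n}})
    (s : {set 'I_n}) x y (Z : pred 'I_n) :
  combinatorial_3manifold R K -> s \in K -> #|s| = 4%N -> x \in s ->
  (forall u v, u != y -> v != y -> [set y; u; v]%SET \in link K x -> Z u -> Z v) ->
  forall u v, u != y -> v != y -> [set y; u]%SET \in link K x ->
    [set y; v]%SET \in link K x -> Z u -> Z v.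
Proof.
move=> [Ksc Klink] sK s4 xs Zadj u v uy vy uL vL; set L := link K x.
have Ldown := link_down (x := x) Ksc.
have xK : [set x]%SET \in K.
  have [_ ] := Ksc _ sK; apply; first by rewrite finset.sub1set.
  by apply/set0Pn; exists x; rewrite inE.
have [p Lp p3] := @link_point R n K s x sK s4 xs.
have vert a b : [set a; b]%SET \in L -> [set b]%SET \in L.
  move=> abL; apply: Ldown abL _ _; last by apply/set0Pn; exists b; rewrite inE.
  by rewrite finset.sub1set !inE eqxx orbT.
pose c a b : 'F_2 := ([&& a == y, b != y & Z b])%:R + ([&& b == y, a != y & Z a])%:R.
have [|psi psiE] := @sphere_cocycle_exact R n L p _ c Ldown (Klink _ xK) Lp p3.
  move=> t a b d tL at_ bt dt.
  have same i j : i \in t -> j \in t -> y \in t -> i != y -> j != y -> Z i = Z j.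
    move=> it jt yt iy jy.
    have tri k l : k \in t -> l \in t -> [set y; k; l]%SET \in L.
      move=> kt lt; apply: Ldown tL _ _.
        by apply/fintype.subsetP => w; rewrite !inE => /orP[/orP[]|] /eqP ->.
      by apply/set0Pn; exists y; rewrite !inE eqxx.
    by apply/idP/idP; apply: Zadj => //; apply: tri.
  pose zt : 'F_2 := [exists i in t, (i != y) && Z i]%:R.
  (* Off [y] the predicate [Z] is constant on a simplex containing [y], so on each simplex [c] is
     the coboundary of [zt] placed at [y]. *)
  have cE i j : i \in t -> j \in t -> c i j = (i == y)%:R * zt + (j == y)%:R * zt.
    have half k l : k \in t -> l \in t -> l != y ->
        ([&& k == y, l != y & Z l])%:R = (k == y)%:R * zt :> 'F_2.
      move=> kt lt ly; rewrite ly /=; case: eqP => [ky|_]; last by rewrite mul0r.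
      rewrite mul1r /zt; congr (_%:R); congr nat_of_bool.
      apply/idP/existsP => [Zl|[w /and3P[wt wy]]]; first by exists l; rewrite lt ly.
      by rewrite (same w l) // -ky.
    move=> it jt; rewrite /c; case: (eqVneq i y) => [iy|iy].
      case: (eqVneq j y) => [jy|jy]; first by rewrite /= addrr_F2 addrr_F2.
      by have := half i j it jt jy; rewrite iy eqxx jy /= => ->; rewrite !mul0r.
    rewrite /= mul0r !add0r; have := half j i jt it iy.
    by rewrite iy.
  by rewrite !cE // -addrA [X in _ + X]addrA addrr_F2 add0r.
have psi0 a b : [set a; b]%SET \in L -> a != y -> b != y -> psi a = psi b.
  move=> abL ay by_; have := psiE a b abL.
  rewrite /c (negbTE ay) (negbTE by_) /= addr0 => /esym/eqP.
  by rewrite subr_eq0 => /eqP.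
have yL : [set y]%SET \in L by rewrite (vert u) // finset.setUC.
have := @sphere_minus_vertex_connected R n L y (fun w => psi w == psi u)
  Ldown (Klink _ xK) yL.
move=> /(_ _ u v (vert _ _ uL) (vert _ _ vL) uy vy) uvE.
have {uvE}/eqP uvE : psi v == psi u.
  rewrite -uvE ?eqxx // => a b abL ay by_; by rewrite (psi0 a b).
(* As [psi u = psi v], the values of [c] on the edges [yu] and [yv], which encode [Z u] and [Z v],
   agree. *)
have := psiE y u uL; have := psiE y v vL; rewrite uvE => <-.
rewrite /c eqxx uy vy (negbTE uy) (negbTE vy) /= !addr0.
by case: (Z u); case: (Z v).
Qed.

(** * Normal discs *)

(** An injection given as a relation, suited to counts whose witnesses come from existential
    statements. *)
Lemma card_le_rel (A B : finType) (X : {set A}) (Y : {set B})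
    (r : A -> B -> Prop) :
  (forall a, a \in X -> exists2 b, b \in Y & r a b) ->
  (forall a a' b, a \in X -> a' \in X -> r a b -> r a' b -> a = a') ->
  (#|X| <= #|Y|)%N.
Proof.
move=> Xr rinj; case: (finset.set_0Vmem X) => [->|[a0 a0X]]; first by rewrite cards0.
have [b0 _ _] := Xr a0 a0X.
have fex a : exists b, a \in X -> b \in Y /\ r a b.
  case: (boolP (a \in X)) => aX; last by exists b0.
  by have [b bY rab] := Xr a aX; exists b.
pose f a := sval (cid (fex a)).
have fP a : a \in X -> f a \in Y /\ r a (f a) := svalP (cid (fex a)).
rewrite -(@card_in_imset _ _ f X); last first.
  move=> a a' aX a'X ff; apply: (rinj a a' (f a)) => //.
    by have [] := fP a aX.
  by rewrite ff; have [] := fP a' a'X.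
apply/subset_leq_card/fintype.subsetP => b /imsetP[a aX ->].
by have [] := fP a aX.
Qed.

Lemma card_dep_pairs (A B : finType) (G : A -> {set B}) :
  #|[set t : A * B | t.2 \in G t.1]%SET| = (\sum_a #|G a|)%N.
Proof.
under eq_bigr => a _ do rewrite -sum1_card.
rewrite pair_big_dep /= -sum1_card; apply: eq_bigl => t.
by rewrite inE.
Qed.

Lemma edge_point (R : realType) n (K : {set {set 'I_n}}) (p : 'rV[R]_n) x y :
  realization K p -> supp p = [set x; y]%SET -> x != y ->
  0 < p 0 x < 1 /\ p = p 0 x *: delta_mx 0 x + (1 - p 0 x) *: delta_mx 0 y.
Proof.
move=> Kp sp xy; have [p0 p1 _] := Kp.
have xs : x \in supp p by rewrite sp !inE eqxx.
have ys : y \in supp p by rewrite sp !inE eqxx orbT.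
have := sum_supp Kp; rewrite sp big_setU1 ?inE //= big_set1 => sxy.
rewrite (supp_gt0 _ Kp) in xs; rewrite (supp_gt0 _ Kp) in ys.
split; first by lra.
apply/rowP => i; rewrite !mxE eqxx /=.
case: (eqVneq i x) => [->|ix]; first by rewrite (negbTE xy) /= mulr1 mulr0 addr0.
case: (eqVneq i y) => [->|iy]; first by rewrite /= mulr0 mulr1; lra.
rewrite !mulr0 addr0; apply/eqP; have := finset.in_set (fun i => p 0 i != 0) i.
by rewrite -/(supp p) sp !inE (negbTE ix) (negbTE iy) => /esym/negbFE.
Qed.

(* [a], [a'] are the positions of the ends on one side of a triangle and [b],
   [b'] those on a second side. *)
Lemma parallel_chords_cross (R : realFieldType) (a a' b b' : R) :
  0 < a < 1 -> 0 < a' < 1 -> 0 < b < 1 -> 0 < b' < 1 -> a < a' -> b' <= b ->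
  exists t t' : R, [/\ 0 <= t <= 1, 0 <= t' <= 1,
    (1 - t) * (1 - a) = (1 - t') * (1 - a'), t * (1 - b) = t' * (1 - b') &
    (1 - t) * a + t * b = (1 - t') * a' + t' * b'].
Proof.
move=> /andP[a0 a1] /andP[a'0 a'1] /andP[b0 b1] /andP[b'0 b'1] aa bb.
(* Up to sign, [d] is the determinant of the first two equations, linear in [t] and [t']. *)
pose d := (1 - b') * (1 - a) - (1 - a') * (1 - b).
have d0 : 0 < d by rewrite /d; nra.
exists ((a' - a) * (1 - b') / d), ((a' - a) * (1 - b) / d); split.
- by rewrite divr_ge0 /= ?ler_pdivrMr ?mul1r /d //; nra.
- by rewrite divr_ge0 /= ?ler_pdivrMr ?mul1r /d //; nra.
- by move: d0; rewrite /d => d0; field; rewrite gt_eqF.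
- by move: d0; rewrite /d => d0; field; rewrite gt_eqF.
- by move: d0; rewrite /d => d0; field; rewrite gt_eqF.
Qed.

(* As above, with the second chord ending at position [c] on the third side. *)
Lemma transverse_chords_cross (R : realFieldType) (a a' b c : R) :
  0 < a < 1 -> 0 < a' < 1 -> 0 < b < 1 -> 0 < c < 1 -> a < a' ->
  exists t t' : R, [/\ 0 <= t <= 1, 0 <= t' <= 1,
    (1 - t) * (1 - a) = (1 - t') * (1 - a') + t' * c,
    t * (1 - b) = t' * (1 - c) &
    (1 - t) * a + t * b = (1 - t') * a'].
Proof.
move=> /andP[a0 a1] /andP[a'0 a'1] /andP[b0 b1] /andP[c0 c1] aa.
pose d := (1 - c) * (b - a) + a' * (1 - b).
have pos u : 0 < u < 1 -> 0 < (1 - b) * u * c + b * (1 - c) * (1 - u).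
  by move=> /andP[u0 u1]; rewrite addr_gt0 // !mulr_gt0 // subr_gt0.
have posa := pos a; rewrite a0 a1 in posa.
have posa' := pos a'; rewrite a'0 a'1 in posa'.
have pab : 0 < (a' - a) * (1 - b) by rewrite mulr_gt0 // subr_gt0.
have pac : 0 < (a' - a) * (1 - c) by rewrite mulr_gt0 // subr_gt0.
(* The two forms of the determinant [d] show that it exceeds both numerators, so that both
   parameters are at most 1. *)
have dE : d = (a' - a) * (1 - b) + ((1 - b) * a * c + b * (1 - c) * (1 - a)).
  by rewrite /d; ring.
have dE' : d = (a' - a) * (1 - c) + ((1 - b) * a' * c + b * (1 - c) * (1 - a')).
  by rewrite /d; ring.
have d0 : 0 < d by rewrite dE addr_gt0 // posa.
exists ((a' - a) * (1 - c) / d), ((a' - a) * (1 - b) / d); split.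
- by rewrite ler_pdivrMr // ler_pdivlMr // mul0r mul1r (ltW pac) dE' lerDl ltW // posa'.
- by rewrite ler_pdivrMr // ler_pdivlMr // mul0r mul1r (ltW pab) dE lerDl ltW // posa.
- by move: d0; rewrite /d => d0; field; rewrite gt_eqF.
- by move: d0; rewrite /d => d0; field; rewrite gt_eqF.
- by move: d0; rewrite /d => d0; field; rewrite gt_eqF.
Qed.

Lemma side_sym (R : realType) n (D : ndisc R n) p q : side D p q = side D q p.
Proof. by rewrite /side finset.setUC; apply/and3P/and3P => -[]; split. Qed.

Lemma side_boundary (R : realType) n (D : ndisc R n) p q (t : R) :
  side D p q -> 0 <= t <= 1 -> boundary D ((1 - t) *: p + t *: q).
Proof. by move=> Dpq t01; exists p, q, t. Qed.

Lemma side_boundaryr (R : realType) n (D : ndisc R n) p q :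
  side D p q -> boundary D q.
Proof.
move=> Dpq; have := side_boundary Dpq (t := 1).
by rewrite ler01 lexx subrr scale0r scale1r add0r; apply.
Qed.

Lemma corner_supp (R : realType) n (K : {set {set 'I_n}}) (D : ndisc R n) p :
  normal_disc K D -> p \in D.2 ->
  [/\ realization K p, #|supp p| = 2%N & supp p \subset D.1].
Proof.
move=> [DK D4 [A [AD _ Dp _]]] /Dp[Kp [a [b [aA]]]].
rewrite !inE => /andP[bA bD] ->; split=> //.
  by rewrite cards2; case: eqP => // ab; move: bA; rewrite -ab aA.
apply/fintype.subsetP => i; rewrite !inE => /orP[] /eqP -> //.
exact: (fintype.subsetP AD).
Qed.

Lemma corner_inj (R : realType) n (K : {set {set 'I_n}}) (D : ndisc R n) p q :
  normal_disc K D -> p \in D.2 -> q \in D.2 -> supp p = supp q -> p = q.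
Proof.
move=> [DK D4 [A [AD _ Dp Du]]] pD qD pq; have [_ [a [b [aA bA sp]]]] := Dp p pD.
have [r [_ ru]] := Du a b aA bA.
by rewrite -(ru p) // -(ru q) // -pq.
Qed.

(** The disc separates [z] from exactly one end of the edge of [p]; the edge from [z] to that end
    carries the next corner. *)
Lemma corner_next (R : realType) n (K : {set {set 'I_n}}) (D : ndisc R n) p z :
  normal_disc K D -> p \in D.2 -> z \in D.1 -> z \notin supp p ->
  exists w q, [/\ w \in supp p, supp q = [set w; z]%SET & side D p q].
Proof.
move=> nD pD zD zp; have [_ c2 _] := corner_supp nD pD.
have sideE w q : w \in supp p -> q \in D.2 -> supp q = [set w; z]%SET -> side D p q.
  move=> wp qD sq; rewrite /side pD qD sq.
  suff -> : (supp p :|: [set w; z] = z |: supp p)%SET by rewrite cardsU1 zp c2.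
  apply/finset.setP => i; rewrite !inE; case: (eqVneq i w) => [->|] /=.
    by move: wp; rewrite inE => ->; rewrite !orbT.
  by rewrite orbC.
case: nD => [DK D4 [A [AD _ Dp Du]]]; have [_ [a [b [aA bA sp]]]] := Dp p pD.
case: (boolP (z \in A)) => zA.
  have [q [[qD sq] _]] := Du z b zA bA; rewrite finset.setUC in sq.
  have bp : b \in supp p by rewrite sp !inE eqxx orbT.
  by exists b, q; split=> //; exact: sideE sq.
have zA' : z \in (D.1 :\: A)%SET by rewrite !inE zA zD.
have [q [[qD sq] _]] := Du a z aA zA'.
have ap : a \in supp p by rewrite sp !inE eqxx.
by exists a, q; split=> //; exact: sideE sq.
Qed.

(** By inclusion-exclusion the two edges share one vertex [x], the corner of the triangle that the
    arc cuts off. *)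
Lemma side_apex (R : realType) n (K : {set {set 'I_n}}) (D : ndisc R n) p q :
  normal_disc K D -> side D p q ->
  exists x y z, [/\ x != y, x != z, y != z,
                    supp p = [set x; y]%SET & supp q = [set x; z]%SET].
Proof.
move=> nD /and3P[pD qD /eqP c3].
have [_ p2 _] := corner_supp nD pD; have [_ q2 _] := corner_supp nD qD.
have /cards1P[x xE] : #|supp p :&: supp q| == 1%N.
  by have := cardsUI (supp p) (supp q); rewrite c3 p2 q2; lia.
have : x \in (supp p :&: supp q)%SET by rewrite xE inE.
rewrite finset.in_setI => /andP[xp xq].
have other (A : {set 'I_n}) : #|A| = 2%N -> x \in A ->
    exists2 y, x != y & A = [set x; y]%SET.
  move=> A2 xA; have /cards1P[y yE] : #|A :\ x| == 1%N.
    by have := cardsD1 x A; rewrite xA A2; lia.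
  have : y \in (A :\ x)%SET by rewrite yE inE.
  rewrite !inE eq_sym => /andP[xy _]; exists y => //.
  by rewrite -(finset.setD1K xA) yE.
have [y xy sp] := other _ p2 xp; have [z xz sq] := other _ q2 xq.
exists x, y, z; split=> //; apply: contra_eqN c3 => /eqP yz.
by rewrite sp sq yz finset.setUid cards2 xz.
Qed.

Lemma vertexP (R : realType) n (S : {fset ndisc R n}) p :
  reflect (exists2 D, D \in S & p \in D.2) (p \in vertices S).
Proof.
apply: (iffP idP) => [/bigfcupP[D]|[D DS pD]].
  by rewrite andbT => DS pD; exists D.
by apply/bigfcupP; exists D => //; rewrite DS.
Qed.

Lemma edge_link_mem n (K : {set {set 'I_n}}) (s A : {set 'I_n}) x :
  simplicial_complex K -> s \in K -> x \in s -> A \subset s -> x \notin A ->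
  A != finset.set0 -> A \in link K x.
Proof.
move=> Ksc sK xs As xA A0; rewrite inE A0 xA /=.
have [_ ] := Ksc _ sK; apply; last by apply/set0Pn; exists x; rewrite !inE eqxx.
by rewrite finset.subUset finset.sub1set xs.
Qed.

(* The discs at [p] can be followed around the edge of [p], since the link of
   this edge is connected. *)
Lemma vertex_in_every_tetrahedron (R : realType) n (K : {set {set 'I_n}})
    (S : {fset ndisc R n}) p x y (s : {set 'I_n}) :
  combinatorial_3manifold R K -> closed_normal_surface K S ->
  p \in vertices S -> supp p = [set x; y]%SET -> x != y ->
  s \in K -> #|s| = 4%N -> x \in s -> y \in s ->
  exists D, [/\ D \in S, D.1 = s & p \in D.2].
Proof.
move=> mK [Sn _ Sc] /vertexP[D0 D0S pD0] sp xy sK s4 xs ys; have [Ksc _] := mK.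
have third (t : {set 'I_n}) : #|t| = 4%N -> exists2 z, z \in t & z \notin supp p.
  move=> t4; have : (0 < #|t :\: supp p|)%N.
    have := cardsID (supp p) t; have := subset_leq_card (finset.subsetIr t (supp p)).
    by rewrite sp cards2 xy t4; lia.
  by case/card_gt0P => z; rewrite inE => /andP[zp zt]; exists z.
(* Passing through the triangle [xyz]: the arc of [D] at [p] in it continues into a disc of [t]. *)
have move_to D z (t : {set 'I_n}) : D \in S -> p \in D.2 -> z \in D.1 ->
    z \notin supp p -> t \in K -> #|t| = 4%N -> x \in t -> y \in t -> z \in t ->
    exists D', [/\ D' \in S, D'.1 = t & p \in D'.2].
  move=> DS pD zD zp tK t4 xt yt zt.
  have [w [q [wp sq spq]]] := corner_next (Sn D DS) pD zD zp.
  have [|D' [D'S D't /and3P[pD' _ _]]] := Sc D p q t DS spq tK t4.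
    rewrite sp sq; apply/fintype.subsetP => i; rewrite !inE.
    move: wp; rewrite sp !inE => /orP[] /eqP -> /orP[] /orP[] /eqP -> //.
  by exists D'.
pose Z z := `[< exists D, [/\ D \in S, p \in D.2 & z \in D.1] >].
have notp z : (z \notin supp p) = (z != x) && (z != y) by rewrite sp !inE negb_or.
have [_ D04 _] := Sn D0 D0S; have D0K : D0.1 \in K by have [] := Sn D0 D0S.
have [_ _ /fintype.subsetP sD0] := corner_supp (Sn D0 D0S) pD0.
have xD0 : x \in D0.1 by apply: sD0; rewrite sp !inE eqxx.
have yD0 : y \in D0.1 by apply: sD0; rewrite sp !inE eqxx orbT.
have [z0 z0D0 z0p] := third _ D04; have [z zs zp] := third _ s4.
have linkE (t : {set 'I_n}) w : t \in K -> x \in t -> y \in t -> w \in t ->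
    w \notin supp p -> [set y; w]%SET \in link K x.
  move=> tK xt yt wt; rewrite notp => /andP[wx wy].
  apply: edge_link_mem tK xt _ _ _ => //.
  - by apply/fintype.subsetP => i; rewrite !inE => /orP[] /eqP ->.
  - by rewrite !inE negb_or xy eq_sym.
  - by apply/set0Pn; exists y; rewrite !inE eqxx.
have /asboolP[D [DS pD zD]] : Z z.
  move: (z0p) (zp); rewrite !notp => /andP[_ z0y] /andP[_ zy].
  apply: (edge_link_connected mK sK s4 xs _ z0y zy
    (linkE _ _ D0K xD0 yD0 z0D0 z0p) (linkE _ _ sK xs ys zs zp)); last first.
    by apply/asboolP; exists D0.
  move=> u v uy vy; rewrite inE => /and3P[_ xN tK] Zu.
  move: xN; rewrite !inE !negb_or => /andP[/andP[_ xu] xv].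
  (* For [u = v] the simplex of the link is only an edge, and there is nothing to cross. *)
  case: (eqVneq u v) => [<-|uv]; first exact/asboolP.
  case/asboolP: Zu => D [DS pD uD].
  set t := (x |: _)%SET in tK.
  have t4 : #|t| = 4%N.
    have yuv : y \notin [set u; v]%SET by rewrite !inE negb_or ![y == _]eq_sym uy.
    rewrite /t cardsU1 -finset.setUA cardsU1 cards2 yuv uv.
    by rewrite !inE !negb_or xy xu xv.
  have [||||D' [D'S D't pD']] := move_to D u t DS pD uD _ tK t4.
  - by rewrite notp [u == x]eq_sym xu uy.
  - by rewrite !inE eqxx.
  - by rewrite !inE eqxx !orbT.
  - by rewrite !inE eqxx !orbT.
  - by exists D'; rewrite D't !inE eqxx !orbT.
exact: move_to DS pD zD zp sK s4 xs ys zs.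
Qed.

(** * Levels of arcs *)

(** A larger coordinate at [x] means nearer to [x], so this is the rank of [p] on its edge, counted
    from 0 at the end [x]. *)
Definition level (R : realType) n (S : {fset ndisc R n}) (x : 'I_n)
    (p : 'rV[R]_n) : nat :=
  #|[set q : vertices S | (supp (val q) == supp p) && (p 0 x < val q 0 x)]|.

Lemma level_le_f0 (R : realType) n (S : {fset ndisc R n}) x p :
  (level S x p <= f0 S)%N.
Proof. by rewrite /f0 cardfE; exact: max_card. Qed.

Lemma vertex_realization (R : realType) n (K : {set {set 'I_n}})
    (S : {fset ndisc R n}) p :
  closed_normal_surface K S -> p \in vertices S -> realization K p.
Proof. by move=> [Sn _ _] /vertexP[D /Sn nD /(corner_supp nD)[]]. Qed.

Lemma side_vertex (R : realType) n (S : {fset ndisc R n}) D p q :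
  D \in S -> side D p q -> p \in vertices S /\ q \in vertices S.
Proof. by move=> DS /and3P[pD qD _]; split; apply/vertexP; exists D. Qed.

Lemma level_inj (R : realType) n (K : {set {set 'I_n}}) (S : {fset ndisc R n})
    p q x y :
  closed_normal_surface K S -> p \in vertices S -> q \in vertices S ->
  supp p = [set x; y]%SET -> supp q = [set x; y]%SET -> x != y ->
  level S x p = level S x q -> p = q.
Proof.
move=> cS pS qS sp sq xy.
wlog pq : p q pS qS sp sq / p 0 x <= q 0 x => [h|].
  case: (leP (p 0 x) (q 0 x)) => [/h|/ltW qp /esym lqp]; first exact.
  by apply/esym; exact: h qp lqp.
have [_ pE] := edge_point (vertex_realization cS pS) sp xy.
have [_ qE] := edge_point (vertex_realization cS qS) sq xy.
case: (eqVneq (p 0 x) (q 0 x)) => [pqx _|pqx lpq]; first by rewrite pE qE pqx.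
have {}pq : p 0 x < q 0 x by rewrite lt_neqAle pqx.
suff : (level S x q < level S x p)%N by rewrite lpq ltnn.
apply: proper_card; apply/fintype.properP; split.
  apply/fintype.subsetP => r; rewrite !inE sp sq => /andP[-> qr] /=.
  exact: lt_trans qr.
by exists [` qS]%fset; rewrite !inE /= ?sp ?sq eqxx ?pq ?ltxx.
Qed.

Lemma disjoint_sides (R : realType) n (K : {set {set 'I_n}})
    (S : {fset ndisc R n}) (D D' : ndisc R n) (u : 'rV[R]_n) :
  closed_normal_surface K S -> D \in S -> D' \in S -> D.1 = D'.1 ->
  boundary D u -> boundary D' u -> D = D'.
Proof.
move=> [_ Sd _] DS D'S DD' Du D'u; apply: contrapT => ne.
have : (boundary D `&` boundary D')%classic u by [].
by rewrite (Sd D D').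
Qed.

(** A vertex [p'] nearer to [x] than [p] starts an arc in the triangle [xyz]. Not crossing the arc
    [pq], it ends on [xz] nearer to [x] than [q]. Disjointness of the discs makes this assignment
    injective. *)
Lemma level_side_le (R : realType) n (K : {set {set 'I_n}})
    (S : {fset ndisc R n}) (D : ndisc R n) p q x y z :
  combinatorial_3manifold R K -> closed_normal_surface K S ->
  D \in S -> side D p q -> x != y -> x != z -> y != z ->
  supp p = [set x; y]%SET -> supp q = [set x; z]%SET ->
  (level S x p <= level S x q)%N.
Proof.
move=> mK cS DS Dpq xy xz yz sp sq; have [Sn _ _] := cS.
have [pS qS] := side_vertex DS Dpq.
have [pD qD _] := and3P Dpq.
have [_ _ /fintype.subsetP sD] := corner_supp (Sn _ DS) pD.
have [_ _ /fintype.subsetP sD'] := corner_supp (Sn _ DS) qD.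
have xD : x \in D.1 by apply: sD; rewrite sp !inE eqxx.
have yD : y \in D.1 by apply: sD; rewrite sp !inE eqxx orbT.
have zD : z \in D.1 by apply: sD'; rewrite sq !inE eqxx orbT.
have [DK D4 _] := Sn _ DS.
have [a01 pE] := edge_point (vertex_realization cS pS) sp xy.
have [b01 qE] := edge_point (vertex_realization cS qS) sq xz.
(* Only discs in the tetrahedron of [D] are used, since disjointness is known within one
   tetrahedron. *)
pose r (p' q' : vertices S) := exists D',
  [/\ D' \in S, D'.1 = D.1 & side D' (val p') (val q')].
apply: (card_le_rel (r := r)); last first.
  move=> p1 p2 q'; rewrite !inE => /andP[/eqP s1 _] /andP[/eqP s2 _].
  move=> [D1 [D1S D1E d1]] [D2 [D2S D2E d2]].
  have DD : D1 = D2.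
    apply: (disjoint_sides (u := val q') cS) => //; first by rewrite D1E.
      exact: side_boundaryr d1.
    exact: side_boundaryr d2.
  apply: val_inj; apply: (corner_inj (Sn _ D1S)); last by rewrite s1.
    by case/and3P: d1.
  by rewrite DD; case/and3P: d2.
move=> [p' p'S]; rewrite !inE /= => /andP[/eqP sp' pp'].
rewrite sp in sp'; have [D' [D'S D'E p'D']] :=
  vertex_in_every_tetrahedron mK cS p'S sp' xy DK D4 xD yD.
have [a'01 p'E] := edge_point (vertex_realization cS p'S) sp' xy.
have DD' : D <> D'.
  move=> DD'; move: pp'; rewrite (corner_inj (Sn _ DS) pD (q := p')) ?ltxx //.
    by rewrite DD'.
  by rewrite sp.
have zp' : z \notin supp p' by rewrite sp' !inE negb_or ![z == _]eq_sym xz.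
rewrite -D'E in zD.
have [w [q' [wp sq' D'pq]]] := corner_next (Sn _ D'S) p'D' zD zp'.
have [_ q'S] := side_vertex D'S D'pq.
have cross t t' : 0 <= t <= 1 -> 0 <= t' <= 1 ->
    (1 - t) *: p + t *: q = (1 - t') *: p' + t' *: q' -> False.
  move=> t01 t'01 E; apply: DD'.
  apply: (disjoint_sides (u := (1 - t) *: p + t *: q) cS) => //.
    exact: side_boundary.
  by rewrite E; exact: side_boundary.
(* The arc from [p'] could end on [yz] or on [xz]; the former is treated first. In both cases a
   crossing is verified by comparing barycentric coordinates at [x], [y] and [z]. *)
move: wp; rewrite sp' !inE => /orP[] /eqP wE; rewrite wE in sq'; last first.
  have [c01 q'E] := edge_point (vertex_realization cS q'S) sq' yz.
  have [t [t' [t01 t'01 E1 E2 E3]]] :=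
    transverse_chords_cross a01 a'01 b01 c01 pp'.
  case: (cross t t' t01 t'01); rewrite pE qE p'E q'E; apply/rowP => i.
  rewrite !mxE; set dx := (_ && (i == x))%:R; set dy := (_ && (i == y))%:R.
  set dz := (_ && (i == z))%:R.
  transitivity (((1 - t) * p 0 x + t * q 0 x) * dx + ((1 - t) * (1 - p 0 x)) * dy
      + (t * (1 - q 0 x)) * dz); first by ring.
  by rewrite E1 E2 E3; ring.
have [b'01 q'E] := edge_point (vertex_realization cS q'S) sq' xz.
exists [` q'S]%fset; last by exists D'.
rewrite inE /= sq' sq eqxx /= ltNge; apply/negP => qq'.
have [t [t' [t01 t'01 E1 E2 E3]]] :=
  parallel_chords_cross a01 a'01 b01 b'01 pp' qq'.
case: (cross t t' t01 t'01); rewrite pE qE p'E q'E; apply/rowP => i.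
rewrite !mxE; set dx := (_ && (i == x))%:R; set dy := (_ && (i == y))%:R.
set dz := (_ && (i == z))%:R.
transitivity (((1 - t) * p 0 x + t * q 0 x) * dx + ((1 - t) * (1 - p 0 x)) * dy
    + (t * (1 - q 0 x)) * dz); first by ring.
by rewrite E1 E2 E3; ring.
Qed.

Lemma level_side (R : realType) n (K : {set {set 'I_n}})
    (S : {fset ndisc R n}) (D : ndisc R n) p q x y z :
  combinatorial_3manifold R K -> closed_normal_surface K S ->
  D \in S -> side D p q -> x != y -> x != z -> y != z ->
  supp p = [set x; y]%SET -> supp q = [set x; z]%SET ->
  level S x p = level S x q.
Proof.
move=> mK cS DS Dpq xy xz yz sp sq; apply/eqP; rewrite eqn_leq; apply/andP; split.
  exact: level_side_le mK cS DS Dpq xy xz yz sp sq.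
by rewrite (level_side_le mK cS DS _ xz xy _ sq sp) // 1?side_sym // eq_sym.
Qed.

(** * Arc graphs in the links of vertices *)

(** The arc is projected from [x] to the opposite side [g] of its triangle, an edge of the link of
    [x]. *)
Definition arc_at (R : realType) n (S : {fset ndisc R n}) (x : 'I_n) (i : nat)
    (g : {set 'I_n}) (p q : 'rV[R]_n) : Prop :=
  exists D y z, [/\ D \in S, side D p q & level S x p = i] /\
    [/\ x != y, x != z, y != z, supp p = [set x; y]%SET &
        supp q = [set x; z]%SET /\ g = [set y; z]%SET].

Definition arc_graph (R : realType) n (S : {fset ndisc R n}) (x : 'I_n)
    (i : nat) : {set {set 'I_n}} :=
  [set g | `[< exists p q, arc_at S x i g p q >]].

Lemma arc_graph_bound (R : realType) n (K : {set {set 'I_n}})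
    (S : {fset ndisc R n}) x i :
  combinatorial_3manifold R K -> orientable_3complex K ->
  closed_normal_surface K S ->
  (#|arc_graph S x i| <= 3 * #|finset.cover (arc_graph S x i)|)%N.
Proof.
move=> mK oK cS; have [Sn _ _] := cS; have [Ksc _] := mK.
(* The empty graph is set apart because an arc is what supplies a tetrahedron at [x]. *)
case: (finset.set_0Vmem (arc_graph S x i)) => [->|[g0 g0G]]; first by rewrite cards0.
have memG g : g \in arc_graph S x i -> [/\ #|g| = 2%N, g \in link K x &
    exists s, [/\ s \in K, #|s| = 4%N & x \in s]].
  rewrite inE => /asboolP[p [q [D [y [z [[DS Dpq _] [xy xz yz sp [sq ->]]]]]]]].
  have [DK D4 _] := Sn _ DS; have [pD qD _] := and3P Dpq.
  have [_ _ /fintype.subsetP sD] := corner_supp (Sn _ DS) pD.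
  have [_ _ /fintype.subsetP sD'] := corner_supp (Sn _ DS) qD.
  have xD : x \in D.1 by apply: sD; rewrite sp !inE eqxx.
  split; [by rewrite cards2 yz| |by exists D.1].
  apply: (edge_link_mem Ksc DK xD).
  - apply/fintype.subsetP => w; rewrite !inE => /orP[] /eqP ->.
      by apply: sD; rewrite sp !inE eqxx orbT.
    by apply: sD'; rewrite sq !inE eqxx orbT.
  - by rewrite !inE negb_or xy.
  - by apply/set0Pn; exists y; rewrite !inE eqxx.
have [_ _ [s [sK s4 xs]]] := memG _ g0G.
apply: (planar_edge_bound (P := [set t in link K x | #|t| == 3%N]%SET)).
- by move=> t; rewrite inE => /andP[_ /eqP].
- by move=> e /memG[].
- by move=> e; exact: link_edge_two_triangles.
- move=> y y0; have [phi phiE] := link_cohomology mK sK s4 xs y0.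
  by exists phi => a b ab /memG[_ abL _]; exact: phiE.
Qed.

Lemma eq_set2 (T : finType) (a b c d : T) : a != b ->
  [set a; b]%SET = [set c; d]%SET -> (a = c /\ b = d) \/ (a = d /\ b = c).
Proof.
move=> ab /finset.setP E; have := E a; have := E b; rewrite !inE !eqxx orbT /=.
move=> /esym/orP[] /eqP bE /esym/orP[] /eqP aE; try by [left|right].
  by move: ab; rewrite aE bE eqxx.
by move: ab; rewrite aE bE eqxx.
Qed.

Lemma edgeP (R : realType) n (S : {fset ndisc R n}) e :
  e \in edges S -> exists D p q, [/\ D \in S, side D p q & e = [fset p; q]%fset].
Proof.
case/bigfcupP => D; rewrite andbT => DS /imfset2P[p /= pD [q]].
by rewrite inE => /andP[_ Dpq] ->; exists D, p, q.
Qed.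

(** An edge of [S] is recovered from its apex [x], its level and the opposite side: both endpoints
    have that level, and a level determines a point on a given edge. *)
Lemma f1_le_arcs (R : realType) n (K : {set {set 'I_n}}) (S : {fset ndisc R n}) :
  combinatorial_3manifold R K -> closed_normal_surface K S ->
  (f1 S <= \sum_(xi : 'I_n * 'I_(f0 S).+1) #|arc_graph S xi.1 xi.2|)%N.
Proof.
move=> mK cS; have [Sn _ _] := cS.
rewrite /f1 cardfE -cardsT -card_dep_pairs.
pose r (e : edges S) (t : 'I_n * 'I_(f0 S).+1 * {set 'I_n}) :=
  exists p q, val e = [fset p; q]%fset /\ arc_at S t.1.1 t.1.2 t.2 p q.
apply: (card_le_rel (r := r)) => [[e eS] _|[e eS] [e' e'S] [[x i] g] _ _ /=].
  have [D [p [q [DS Dpq eE]]]] := edgeP eS.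
  have [x [y [z [xy xz yz sp sq]]]] := side_apex (Sn _ DS) Dpq.
  have at_ : arc_at S x (inord (level S x p) : 'I_(f0 S).+1) [set y; z]%SET p q.
    by exists D, y, z; rewrite inordK ?ltnS ?level_le_f0.
  exists (x, inord (level S x p), [set y; z]%SET); last by exists p, q.
  by rewrite !inE /=; exists p, q.
move=> [p [q [/= eE [D [y [z [[DS Dpq lp] [xy xz yz sp [sq gE]]]]]]]]].
move=> [p' [q' [/= e'E [D' [y' [z' [[D'S D'pq lp'] [xy' xz' yz' sp' [sq' gE']]]]]]]]].
apply: val_inj => /=; rewrite eE e'E.
have lq := level_side mK cS DS Dpq xy xz yz sp sq.
have lq' := level_side mK cS D'S D'pq xy' xz' yz' sp' sq'.
have [pS qS] := side_vertex DS Dpq; have [p'S q'S] := side_vertex D'S D'pq.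
rewrite gE in gE'; case: (eq_set2 yz gE') => -[yE zE].
  rewrite -yE in sp'; rewrite -zE in sq'.
  rewrite (level_inj cS pS p'S sp sp' xy) ?lp //.
  by rewrite (level_inj cS qS q'S sq sq' xz) // -lq -lq' lp.
rewrite -zE in sp'; rewrite -yE in sq'.
rewrite (level_inj cS pS q'S sp sq' xy) -?lq' ?lp //.
by rewrite (level_inj cS qS p'S sq sp' xz) -?lq ?lp // fsetUC.
Qed.

(* A vertex on the edge [xy] is met at one level from [x] and one from [y]. *)
Lemma sum_cover_arcs (R : realType) n (K : {set {set 'I_n}})
    (S : {fset ndisc R n}) :
  combinatorial_3manifold R K -> closed_normal_surface K S ->
  (\sum_(xi : 'I_n * 'I_(f0 S).+1) #|finset.cover (arc_graph S xi.1 xi.2)|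
    <= 2 * f0 S)%N.
Proof.
move=> mK cS; rewrite -card_dep_pairs.
have -> : (2 * f0 S = #|[set: vertices S * bool]%SET|)%N.
  by rewrite cardsT card_prod card_bool /f0 cardfE mulnC.
(* The boolean records from which end of its edge the vertex is seen. *)
pose r (t : 'I_n * 'I_(f0 S).+1 * 'I_n) (u : vertices S * bool) :=
  [/\ supp (val u.1) = [set t.1.1; t.2]%SET, t.1.1 != t.2,
      level S t.1.1 (val u.1) = t.1.2 & u.2 = (t.1.1 < t.2)%N].
apply: (card_le_rel (r := r)) => [[[x i] y]|]; last first.
  move=> [[x i] y] [[x' i'] y'] [u b] _ _ [/= s1 xy l1 ->] [/= s2 xy' l2 b2].
  rewrite s1 in s2; case: (eq_set2 xy s2) => -[xE yE].
    by congr (_, _, _) => //; apply: val_inj; rewrite /= -l1 -l2 xE.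
  by move: b2 xy; rewrite xE yE -val_eqE /=; lia.
rewrite inE /= => /bigcupP[g]; rewrite inE => /asboolP[p [q]].
move=> [D [y1 [z1 [[DS Dpq lp] [xy xz yz sp [sq ->]]]]]].
have lq := level_side mK cS DS Dpq xy xz yz sp sq.
have [pS qS] := side_vertex DS Dpq.
rewrite !inE => /orP[] /eqP ->.
  by exists ([` pS]%fset, (x < y1)%N); [rewrite inE|split].
by exists ([` qS]%fset, (x < z1)%N); [rewrite inE|split; rewrite //= -lq].
Qed.

(** * The edge count and the Euler characteristic *)

Lemma f1_le_6f0 (R : realType) n (K : {set {set 'I_n}}) (S : {fset ndisc R n}) :
  combinatorial_3manifold R K -> orientable_3complex K ->
  closed_normal_surface K S -> (f1 S <= 6 * f0 S)%N.
Proof.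
move=> mK oK cS; apply: leq_trans (f1_le_arcs mK cS) _.
apply: (@leq_trans (3 * (2 * f0 S))); last by rewrite mulnA.
apply: leq_trans (leq_mul (leqnn 3) (sum_cover_arcs mK cS)).
by rewrite big_distrr /=; apply: leq_sum => xi _; exact: arc_graph_bound mK oK cS.
Qed.

Lemma f0_gt0 (R : realType) n (K : {set {set 'I_n}}) (S : {fset ndisc R n}) :
  closed_normal_surface K S -> S != fset0%fset -> (0 < f0 S)%N.
Proof.
move=> [Sn _ _] /fset0Pn[D DS]; have [_ D4 [A [AD A12 _ Du]]] := Sn D DS.
have [a aA] : exists a, a \in A by apply/card_gt0P; case: A12 => ->.
have [b bA] : exists b, b \in (D.1 :\: A)%SET.
  by apply/card_gt0P; rewrite cardsD (finset.setIidPr AD) D4; case: A12 => ->.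
have [p [[pD _] _]] := Du a b aA bA.
by rewrite cardfs_gt0; apply/fset0Pn; exists p; apply/vertexP; exists D.
Qed.

Theorem theorem28 (R : realType) (n : nat) (K : {set {set 'I_n}})
    (S : {fset ndisc R n}) :
  combinatorial_3manifold R K ->
  orientable_3complex K ->
  closed_normal_surface K S ->
  S != fset0%fset ->
  connected_surface S ->
  orientable_surface S ->
  2 * genus S < 7 * (f0 S)%:R.
Proof.
move=> mK oK cS S0 _ _.
have f1_le := f1_le_6f0 mK oK cS; have f0_pos := f0_gt0 cS S0.
have f2_pos : (0 < f2 S)%N by rewrite cardfs_gt0.
have -> : 2 * genus S = (2 - euler_char S)%:~R by rewrite /genus mulrC divfK.
have -> : 7 * (f0 S)%:R = (7 * f0 S)%N%:Z%:~R :> rat by rewrite -pmulrn natrM.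
(* Twice the genus is [2 - f0 + f1 - f2], at most [5 f0 + 1] by [f1_le] and [f2_pos], and
   [1 < 2 f0]. *)
rewrite ltr_int /euler_char; lia.
Qed.
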